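(* Let $\mathfrak g$ be a complex Lie superalgebra, $\mathfrak p$ a ($\mathbb Z_2$-graded) ideal of $\mathfrak g$, and $\phi\colon\mathfrak p\to\mathbb C$ a Lie superalgebra homomorphism. Assume that $$\mathfrak g^\phi_{\bar 0}=\mathfrak p_{\bar 0}\oplus\mathbb C y_0,\qquad \mathfrak g^\phi_{\bar 1}=\mathfrak p_{\bar 1}\oplus\mathbb C y_1$$ (with $y_0,y_1\ne0$) and $$[y_1,y_1]=\lambda y_0+p_0,\qquad [y_0,y_1]=\mu y_1+p_1,$$ where $p_0\in\mathfrak p_{\bar 0}$, $p_1\in\mathfrak p_{\bar 1}$ and $\lambda,\mu\in\mathbb C$. Then every irreducible quasi-Whittaker $\mathfrak g$-supermodule of type $\phi$ is isomorphic, up to parity shift, to $L_\xi(\phi)$ for a unique $\xi\in\mathbb C$.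
   Context: All Lie superalgebras and supermodules are over $\mathbb C$, of arbitrary dimension; $\mathbb C$ is regarded as a purely even abelian Lie superalgebra. Irreducible means having no nonzero proper ($\mathbb Z_2$-graded) subsupermodule. The Whittaker annihilator of $\phi$ is $\mathfrak g^\phi=\{y\in\mathfrak g\mid \phi([y,p])=0\ \forall p\in\mathfrak p\}$; it is a graded subalgebra containing $\mathfrak p$. For a $\mathfrak g$-supermodule $V$, $V_\phi=\{v\in V\mid pv=\phi(p)v\ \forall p\in\mathfrak p\}$; $V$ is a quasi-Whittaker supermodule of type $\phi$ if it is generated by a homogeneous element of $V_\phi$. Let $\mathbb C w_\phi$ be the one-dimensional $\mathfrak p$-supermodule, with $w_\phi$ even, given by $pw_\phi=\phi(p)w_\phi$; $W(\phi)=\mathrm{Ind}_{\mathfrak p}^{\mathfrak g}\mathbb C w_\phi=\mathcal U(\mathfrak g)\otimes_{\mathcal U(\mathfrak p)}\mathbb C w_\phi$. For $\xi\in\mathbb C$ set $\widetilde L_\xi(\phi)=W(\phi)/\mathcal U(\mathfrak g)(y_0-\xi1)w_\phi$, and let $\overline{u}$ denote the image in it of $u\in W(\phi)$. Define $L_\xi(\phi)=\widetilde L_\xi(\phi)$ if $\lambda\xi+\phi(p_0)\neq0$, and $L_\xi(\phi)=\widetilde L_\xi(\phi)/\mathcal U(\mathfrak g)\overline{y_1w_\phi}$ if $\lambda\xi+\phi(p_0)=0$. ''Isomorphic up to parity shift to $M$'' means isomorphic (by a parity-preserving isomorphism) to $M$ or to its parity shift. *)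

(* Defs.v *)
From HB Require Import structures.
From mathcomp Require Import all_boot all_order all_algebra.
From mathcomp Require Import boolp classical_sets reals complex.

Set Implicit Arguments.
Unset Strict Implicit.
Unset Printing Implicit Defensive.

Import GRing.Theory Num.Theory.
Local Open Scope ring_scope.
Local Open Scope classical_set_scope.
Local Open Scope quotient_scope.

(* In [homog b], [b = false] is the even part and [b = true] the odd part.   *)
HB.mixin Record Lmodule_isSuperspace (K : numFieldType) V
    of GRing.Lmodule K V := {
  homog : bool -> set V;
  homog0 : forall b, homog b 0;
  homogP : forall b (c : K) u v,
    homog b u -> homog b v -> homog b (c *: u + v);
  homog_dec : forall v,
    exists v0 v1, [/\ homog false v0, homog true v1 & v = v0 + v1];
  homog_cap : forall v, homog false v -> homog true v -> v = 0
}.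

#[short(type="superspaceType")]
HB.structure Definition Superspace (K : numFieldType) :=
  {V of GRing.Lmodule K V & Lmodule_isSuperspace K V}.

HB.mixin Record Superspace_isLieSuperalgebra (K : numFieldType) g
    of Superspace K g := {
  bracket : g -> g -> g;
  bracket_linl : forall (c : K) x y z,
    bracket (c *: x + y) z = c *: bracket x z + bracket y z;
  bracket_linr : forall (c : K) x y z,
    bracket z (c *: x + y) = c *: bracket z x + bracket z y;
  bracket_homog : forall b c x y,
    homog b x -> homog c y -> homog (b (+) c) (bracket x y);
  bracket_skew : forall b c x y, homog b x -> homog c y ->
    bracket x y = - ((-1) ^+ (b && c) *: bracket y x);
  bracket_jacobi : forall b c x y z, homog b x -> homog c y ->
    bracket x (bracket y z) =
      bracket (bracket x y) z + (-1) ^+ (b && c) *: bracket y (bracket x z)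
}.

#[short(type="lieSuperalgType")]
HB.structure Definition LieSuperalgebra (K : numFieldType) :=
  {g of Superspace K g & Superspace_isLieSuperalgebra K g}.

HB.mixin Record Superspace_isLieSupermodule (K : numFieldType)
    (g : lieSuperalgType K) V of Superspace K V := {
  act : g -> V -> V;
  act_linl : forall (c : K) x y v, act (c *: x + y) v = c *: act x v + act y v;
  act_linr : forall (c : K) x u v, act x (c *: u + v) = c *: act x u + act x v;
  act_homog : forall b c x v,
    homog b x -> homog c v -> homog (b (+) c) (act x v);
  act_bracket : forall b c x y v, homog b x -> homog c y ->
    act (bracket x y) v =
      act x (act y v) - (-1) ^+ (b && c) *: act y (act x v)
}.

#[short(type="lieSupermodType")]
HB.structure Definition LieSupermodule (K : numFieldType)
    (g : lieSuperalgType K) :=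
  {V of Superspace K V & Superspace_isLieSupermodule K g V}.

Arguments homogP {K s} [b] c [u v].
Arguments bracket_homog {K s} [b c x y].
Arguments bracket_skew {K s} [b c x y].
Arguments bracket_jacobi {K s} [b c x y] z.
Arguments act_homog {K g s} [b c x v].
Arguments act_bracket {K g s} [b c x y] v.

Section SuperspaceTheory.
Variables (K : numFieldType) (V : superspaceType K).
Implicit Types (u v : V) (b : bool).

Lemma homogD b u v : homog b u -> homog b v -> homog b (u + v).
Proof. by move=> hu hv; rewrite -[u]scale1r; apply: homogP. Qed.

Lemma homogZ b (c : K) u : homog b u -> homog b (c *: u).
Proof. by move=> hu; rewrite -[_ *: _]addr0; apply: homogP => //; apply: homog0. Qed.

Lemma homogN b u : homog b u -> homog b (- u).
Proof. by rewrite -scaleN1r; apply: homogZ. Qed.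

Lemma homog_uniq u0 u1 v0 v1 : homog false u0 -> homog false v0 ->
  homog true u1 -> homog true v1 -> u0 + u1 = v0 + v1 -> u0 = v0 /\ u1 = v1.
Proof.
move=> hu0 hv0 hu1 hv1 h.
have e : u0 - v0 = v1 - u1.
  by apply/eqP; rewrite subr_eq addrAC [v1 + v0]addrC -h addrK.
have z : u0 - v0 = 0.
  apply: homog_cap; first by apply: homogD => //; apply: homogN.
  by rewrite e; apply: homogD => //; apply: homogN.
have e0 : u0 = v0 by apply/eqP; rewrite -subr_eq0 z.
by split=> //; apply/esym/eqP; rewrite -subr_eq0 -e z.
Qed.

Lemma parity_ex v : exists w, exists v0 v1,
  [/\ homog false v0, homog true v1, v = v0 + v1 & w = v0 - v1].
Proof. by have [v0 [v1 [h0 h1 e]]] := homog_dec v; exists (v0 - v1), v0, v1. Qed.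

(* The involution acting by (-1)^b on the part of parity b.                  *)
Definition parity v : V := sval (cid (parity_ex v)).

Lemma parityE v0 v1 : homog false v0 -> homog true v1 ->
  parity (v0 + v1) = v0 - v1.
Proof.
move=> h0 h1; rewrite /parity; case: cid => w /= [u0 [u1 [k0 k1 e ->]]].
by have [-> ->] := homog_uniq h0 k0 h1 k1 e.
Qed.

Lemma parity_homog b v : homog b v -> parity v = (-1) ^+ b *: v.
Proof.
case: b => hv; rewrite ?expr1 ?expr0 ?scaleN1r ?scale1r.
  by rewrite -{1}[v]add0r parityE ?sub0r //; apply: homog0.
by rewrite -{1}[v]addr0 parityE ?subr0 //; apply: homog0.
Qed.

Lemma parity_lin (c : K) u v : parity (c *: u + v) = c *: parity u + parity v.
Proof.
have [u0 [u1 [h0 h1 ->]]] := homog_dec u; have [v0 [v1 [k0 k1 ->]]] := homog_dec v.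
rewrite scalerDr addrACA !parityE //; try exact: homogP.
by rewrite scalerBr opprD addrACA.
Qed.

End SuperspaceTheory.

Lemma lin_D (K : numFieldType) (U V : lmodType K) (f : U -> V) :
  (forall (c : K) u v, f (c *: u + v) = c *: f u + f v) ->
  [/\ {morph f : u v / u + v}, forall (c : K) u, f (c *: u) = c *: f u & f 0 = 0].
Proof.
move=> h; have h0 : f 0 = 0.
  by apply: (addrI (f 0)); rewrite addr0 -{1}[f 0]scale1r -h scale1r addr0.
split=> // [u v|c u]; first by rewrite -{1}[u]scale1r h scale1r.
by rewrite -[c *: u]addr0 h h0 addr0.
Qed.

Lemma sg2_eq0 (K : numFieldType) (V : lmodType K) (v : V) : v = - v -> v = 0.
Proof.
move=> /eqP; rewrite -subr_eq0 opprK -mulr2n -scaler_nat scaler_eq0 pnatr_eq0 /=.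
by move/eqP.
Qed.

Section ActTheory.
Variables (K : numFieldType) (g : lieSuperalgType K) (V : lieSupermodType g).
Implicit Types (x y : g) (v : V).

Lemma actDl x y v : act (x + y) v = act x v + act y v.
Proof. by have [-> _ _] := lin_D (fun (c : K) x y => act_linl c x y v). Qed.
Lemma actZl (c : K) x v : act (c *: x) v = c *: act x v.
Proof. by have [_ -> _] := lin_D (fun (c : K) x y => act_linl c x y v). Qed.
Lemma actDr x u v : act x (u + v) = act x u + act x v.
Proof. by have [-> _ _] := lin_D (fun (c : K) (u v : V) => act_linr c x u v). Qed.
Lemma actZr (c : K) x v : act x (c *: v) = c *: act x v.
Proof. by have [_ -> _] := lin_D (fun (c : K) (u v : V) => act_linr c x u v). Qed.
Lemma actr0 x : act x (0 : V) = 0.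
Proof. by have [_ _ ->] := lin_D (fun (c : K) (u v : V) => act_linr c x u v). Qed.

Lemma parity_act x v : parity (act x v) = act (parity x) (parity v).
Proof.
have [x0 [x1 [h0 h1 ->]]] := homog_dec x; have [v0 [v1 [k0 k1 ->]]] := homog_dec v.
rewrite [parity (x0 + x1)]parityE // [parity (v0 + v1)]parityE //.
have -> : act (x0 + x1) (v0 + v1) =
    (act x0 v0 + act x1 v1) + (act x1 v0 + act x0 v1).
  by rewrite !actDl !actDr [act x1 v0 + _]addrC addrACA [act x0 v1 + _]addrC.
rewrite parityE; last 2 first.
- by apply: homogD; [exact: (act_homog h0 k0)|exact: (act_homog h1 k1)].
- by apply: homogD; [exact: (act_homog h1 k0)|exact: (act_homog h0 k1)].
have N1 y (w : V) : act (- y) w = - act y w by rewrite -[- y]scaleN1r actZl scaleN1r.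
have N2 y (w : V) : act y (- w) = - act y w by rewrite -[- w]scaleN1r actZr scaleN1r.
rewrite !actDl !actDr !N1 !N2 opprK.
by rewrite [- act x1 v0 + _]addrC addrACA opprD [- act x0 v1 - _]addrC.
Qed.
End ActTheory.

Record lieHom (K : numFieldType) (h g : lieSuperalgType K) := LieHom {
  lieHom_fun :> h -> g;
  lieHom_lin : linear lieHom_fun;
  lieHom_homog : forall b x, homog b x -> homog b (lieHom_fun x);
  lieHom_bracket : forall x y,
    lieHom_fun (bracket x y) = bracket (lieHom_fun x) (lieHom_fun y)
}.

Section LieHomTheory.
Variables (K : numFieldType) (h g : lieSuperalgType K) (f : lieHom h g).

Lemma lieHomD x y : f (x + y) = f x + f y.
Proof. by have [-> _ _] := lin_D (lieHom_lin f). Qed.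
Lemma lieHomZ (c : K) x : f (c *: x) = c *: f x.
Proof. by have [_ -> _] := lin_D (lieHom_lin f). Qed.

Lemma lieHom_parity x : f (parity x) = parity (f x).
Proof.
have [x0 [x1 [h0 h1 ->]]] := homog_dec x.
rewrite parityE // !lieHomD parityE; try exact: lieHom_homog.
by rewrite -[- x1]scaleN1r lieHomZ scaleN1r.
Qed.
End LieHomTheory.

Section ParityHom.
Variables (K : numFieldType) (g : lieSuperalgType K).

Lemma parity_homogW b (x : g) : homog b x -> homog b (parity x).
Proof. by move=> hx; rewrite (parity_homog hx); apply: homogZ. Qed.

Lemma bracketDl (x y z : g) : bracket (x + y) z = bracket x z + bracket y z.
Proof. by have [-> _ _] := lin_D (fun (c : K) (x y : g) => bracket_linl c x y z). Qed.
Lemma bracketZl (c : K) (x z : g) : bracket (c *: x) z = c *: bracket x z.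
Proof. by have [_ -> _] := lin_D (fun (c : K) (x y : g) => bracket_linl c x y z). Qed.
Lemma bracketDr (x y z : g) : bracket z (x + y) = bracket z x + bracket z y.
Proof. by have [-> _ _] := lin_D (fun (c : K) (x y : g) => bracket_linr c x y z). Qed.
Lemma bracketZr (c : K) (x z : g) : bracket z (c *: x) = c *: bracket z x.
Proof. by have [_ -> _] := lin_D (fun (c : K) (x y : g) => bracket_linr c x y z). Qed.

Lemma parity_bracket (x y : g) :
  parity (bracket x y) = bracket (parity x) (parity y).
Proof.
have [x0 [x1 [h0 h1 ->]]] := homog_dec x; have [v0 [v1 [k0 k1 ->]]] := homog_dec y.
rewrite [parity (x0 + x1)]parityE // [parity (v0 + v1)]parityE //.
have -> : bracket (x0 + x1) (v0 + v1) =
    (bracket x0 v0 + bracket x1 v1) + (bracket x1 v0 + bracket x0 v1).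
  by rewrite !bracketDl !bracketDr [bracket x1 v0 + _]addrC addrACA [bracket x0 v1 + _]addrC.
rewrite parityE; last 2 first.
- by apply: homogD; [exact: (bracket_homog h0 k0)|exact: (bracket_homog h1 k1)].
- by apply: homogD; [exact: (bracket_homog h1 k0)|exact: (bracket_homog h0 k1)].
have N1 (u w : g) : bracket (- u) w = - bracket u w
  by rewrite -[- u]scaleN1r bracketZl scaleN1r.
have N2 (u w : g) : bracket u (- w) = - bracket u w
  by rewrite -[- w]scaleN1r bracketZr scaleN1r.
rewrite !bracketDl !bracketDr !N1 !N2 opprK.
by rewrite [- bracket x1 v0 + _]addrC addrACA opprD [- bracket x0 v1 - _]addrC.
Qed.

Definition parityHom : lieHom g g :=
  LieHom (@parity_lin K g) parity_homogW parity_bracket.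
End ParityHom.

Section ClassicalQuotient.
Variables (T : choiceType) (E : T -> T -> Prop).
Hypotheses (E_refl : forall x, E x x) (E_sym : forall x y, E x y -> E y x)
  (E_trans : forall x y z, E x y -> E y z -> E x z).

Definition cq_rel : rel T := fun x y => `[< E x y >].

Lemma cq_equiv : equiv_class_of cq_rel.
Proof.
split=> [x|x y|y x z]; first exact/asboolP.
  by apply/asboolP/asboolP; apply: E_sym.
by move=> /asboolP h1 /asboolP h2; apply/asboolP; apply: E_trans h1 h2.
Qed.

Definition cq_equiv_rel : equiv_rel T := EquivRelPack cq_equiv.
Definition cq := {eq_quot cq_equiv_rel}.
Definition cq_pi (x : T) : cq := \pi_cq x.

Lemma cq_piP x y : cq_pi x = cq_pi y <-> E x y.
Proof.
split=> [/eqP|h]; first by rewrite /cq_pi eqmodE => /asboolP.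
by apply/eqP; rewrite /cq_pi eqmodE; apply/asboolP.
Qed.

Lemma cq_surj (q : cq) : exists x, cq_pi x = q.
Proof. by exists (repr q); rewrite /cq_pi reprK. Qed.

Lemma cq_repr x : E (repr (cq_pi x)) x.
Proof. by apply/cq_piP; rewrite /cq_pi reprK. Qed.
End ClassicalQuotient.

(* The enveloping algebra: the unital associative K-algebra generated by the  *)
(* vector space g subject to x y - (-1)^(|x||y|) y x = [x, y] for homogeneous *)
(* x, y. It is built as formal algebra expressions in the elements of g       *)
(* modulo the congruence generated by the algebra axioms, the linearity of    *)
(* the map from g, and these relations.                                       *)

Inductive uterm (K : numFieldType) (g : lieSuperalgType K) :=
| UGen of g
| UZero
| UOne
| UAdd of uterm g & uterm g
| UScale of K & uterm g
| UMul of uterm g & uterm g.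

Arguments UGen {K g}.
Arguments UZero {K g}.
Arguments UOne {K g}.

Inductive ueq (K : numFieldType) (g : lieSuperalgType K) :
    uterm g -> uterm g -> Prop :=
| UE_refl s : ueq s s
| UE_sym s t : ueq s t -> ueq t s
| UE_trans s t r : ueq s t -> ueq t r -> ueq s r
| UE_add s s' t t' : ueq s s' -> ueq t t' -> ueq (UAdd s t) (UAdd s' t')
| UE_scale c s s' : ueq s s' -> ueq (UScale c s) (UScale c s')
| UE_mul s s' t t' : ueq s s' -> ueq t t' -> ueq (UMul s t) (UMul s' t')
| UE_addA r s t : ueq (UAdd r (UAdd s t)) (UAdd (UAdd r s) t)
| UE_addC s t : ueq (UAdd s t) (UAdd t s)
| UE_add0 s : ueq (UAdd UZero s) s
| UE_addN s : ueq (UAdd (UScale (-1) s) s) UZero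
| UE_scaleA a b s : ueq (UScale a (UScale b s)) (UScale (a * b) s)
| UE_scale1 s : ueq (UScale 1 s) s
| UE_scaleDr a s t : ueq (UScale a (UAdd s t)) (UAdd (UScale a s) (UScale a t))
| UE_scaleDl a b s : ueq (UScale (a + b) s) (UAdd (UScale a s) (UScale b s))
| UE_mulA r s t : ueq (UMul r (UMul s t)) (UMul (UMul r s) t)
| UE_mul1l s : ueq (UMul UOne s) s
| UE_mul1r s : ueq (UMul s UOne) s
| UE_mulDl r s t : ueq (UMul (UAdd r s) t) (UAdd (UMul r t) (UMul s t))
| UE_mulDr r s t : ueq (UMul r (UAdd s t)) (UAdd (UMul r s) (UMul r t))
| UE_scaleAl a s t : ueq (UScale a (UMul s t)) (UMul (UScale a s) t)
| UE_scaleAr a s t : ueq (UScale a (UMul s t)) (UMul s (UScale a t))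
| UE_genD x y : ueq (UGen (x + y)) (UAdd (UGen x) (UGen y))
| UE_genZ a x : ueq (UGen (a *: x)) (UScale a (UGen x))
| UE_bracket b c x y : homog b x -> homog c y ->
    ueq (UGen (bracket x y))
      (UAdd (UMul (UGen x) (UGen y))
            (UScale (- (-1) ^+ (b && c)) (UMul (UGen y) (UGen x)))).

HB.instance Definition _ (K : numFieldType) (g : lieSuperalgType K) :=
  gen_eqMixin (uterm g).
HB.instance Definition _ (K : numFieldType) (g : lieSuperalgType K) :=
  gen_choiceMixin (uterm g).

Definition Uea (K : numFieldType) (g : lieSuperalgType K) :=
  cq (@UE_refl K g) (@UE_sym K g) (@UE_trans K g).

HB.instance Definition _ (K : numFieldType) (g : lieSuperalgType K) :=
  Choice.on (Uea g).

Section UeaRing.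
Variables (K : numFieldType) (g : lieSuperalgType K).
Implicit Types (s t : uterm g) (u v w : Uea g).

Definition upi : uterm g -> Uea g := cq_pi _ _ _.
Definition urep : Uea g -> uterm g := repr.

Lemma upiP s t : upi s = upi t <-> ueq s t. Proof. exact: cq_piP. Qed.
Lemma upi_surj u : exists s, upi s = u. Proof. exact: cq_surj. Qed.
Lemma urepP s : ueq (urep (upi s)) s. Proof. exact: cq_repr. Qed.

Definition uea0 := upi UZero.
Definition uea1 := upi UOne.
Definition uea_add u v := upi (UAdd (urep u) (urep v)).
Definition uea_scale c u := upi (UScale c (urep u)).
Definition uea_mul u v := upi (UMul (urep u) (urep v)).

Lemma uea_addE s t : uea_add (upi s) (upi t) = upi (UAdd s t).
Proof. by apply/upiP; apply: UE_add; apply: urepP. Qed.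
Lemma uea_scaleE c s : uea_scale c (upi s) = upi (UScale c s).
Proof. by apply/upiP; apply: UE_scale; apply: urepP. Qed.
Lemma uea_mulE s t : uea_mul (upi s) (upi t) = upi (UMul s t).
Proof. by apply/upiP; apply: UE_mul; apply: urepP. Qed.

Let E := (uea_addE, uea_scaleE, uea_mulE).

Fact uea_addA : associative uea_add.
Proof.
move=> u v w; have [r <-] := upi_surj u; have [s <-] := upi_surj v.
by have [t <-] := upi_surj w; rewrite !E; apply/upiP; constructor.
Qed.
Fact uea_addC : commutative uea_add.
Proof.
move=> u v; have [r <-] := upi_surj u; have [s <-] := upi_surj v.
by rewrite !E; apply/upiP; constructor.
Qed.
Fact uea_add0 : left_id uea0 uea_add.
Proof. by move=> u; have [r <-] := upi_surj u; rewrite !E; apply/upiP; constructor. Qed.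
Fact uea_addN : left_inverse uea0 (uea_scale (-1)) uea_add.
Proof. by move=> u; have [r <-] := upi_surj u; rewrite !E; apply/upiP; constructor. Qed.

HB.instance Definition _ :=
  GRing.isZmodule.Build (Uea g) uea_addA uea_addC uea_add0 uea_addN.

Fact uea_scaleA a b u : uea_scale a (uea_scale b u) = uea_scale (a * b) u.
Proof. by have [r <-] := upi_surj u; rewrite !E; apply/upiP; constructor. Qed.
Fact uea_scale1 : left_id 1 uea_scale.
Proof. by move=> u; have [r <-] := upi_surj u; rewrite !E; apply/upiP; constructor. Qed.
Fact uea_scaleDr : right_distributive uea_scale +%R.
Proof.
move=> a u v; have [r <-] := upi_surj u; have [s <-] := upi_surj v.
by rewrite /GRing.add /= !E; apply/upiP; constructor.
Qed.
Fact uea_scaleDl u : {morph uea_scale^~ u : a b / a + b}.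
Proof.
move=> a b; have [r <-] := upi_surj u.
by rewrite {2}/GRing.add /= !E; apply/upiP; constructor.
Qed.

HB.instance Definition _ := GRing.Zmodule_isLmodule.Build K (Uea g)
  uea_scaleA uea_scale1 uea_scaleDr uea_scaleDl.

Fact uea_mulA : associative uea_mul.
Proof.
move=> u v w; have [r <-] := upi_surj u; have [s <-] := upi_surj v.
by have [t <-] := upi_surj w; rewrite !E; apply/upiP; constructor.
Qed.
Fact uea_mul1l : left_id uea1 uea_mul.
Proof. by move=> u; have [r <-] := upi_surj u; rewrite !E; apply/upiP; constructor. Qed.
Fact uea_mul1r : right_id uea1 uea_mul.
Proof. by move=> u; have [r <-] := upi_surj u; rewrite !E; apply/upiP; constructor. Qed.
Fact uea_mulDl : left_distributive uea_mul +%R.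
Proof.
move=> u v w; have [r <-] := upi_surj u; have [s <-] := upi_surj v.
by have [t <-] := upi_surj w; rewrite /GRing.add /= !E; apply/upiP; constructor.
Qed.
Fact uea_mulDr : right_distributive uea_mul +%R.
Proof.
move=> u v w; have [r <-] := upi_surj u; have [s <-] := upi_surj v.
by have [t <-] := upi_surj w; rewrite /GRing.add /= !E; apply/upiP; constructor.
Qed.

Fixpoint uaug (t : uterm g) : K :=
  match t with
  | UGen _ => 0 | UZero => 0 | UOne => 1
  | UAdd s t => uaug s + uaug t
  | UScale c s => c * uaug s
  | UMul s t => uaug s * uaug t
  end.

Lemma uaugP s t : ueq s t -> uaug s = uaug t.
Proof.
elim=> //=; do ?by move=> *; congruence.
- by move=> *; rewrite addrA.
- by move=> *; rewrite addrC.
- by move=> *; rewrite add0r.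
- by move=> *; rewrite mulN1r addNr.
- by move=> *; rewrite mulrA.
- by move=> *; rewrite mul1r.
- by move=> *; rewrite mulrDr.
- by move=> *; rewrite mulrDl.
- by move=> *; rewrite mulrA.
- by move=> *; rewrite mul1r.
- by move=> *; rewrite mulr1.
- by move=> *; rewrite mulrDl.
- by move=> *; rewrite mulrDr.
- by move=> *; rewrite mulrA.
- by move=> *; rewrite mulrCA.
- by move=> *; rewrite addr0.
- by move=> *; rewrite mulr0.
- by move=> *; rewrite !mulr0 addr0.
Qed.

Fact uea1_neq0 : uea1 != 0.
Proof. by apply/eqP => /upiP /uaugP /eqP; rewrite /= oner_eq0. Qed.

HB.instance Definition _ := GRing.Zmodule_isNzRing.Build (Uea g)
  uea_mulA uea_mul1l uea_mul1r uea_mulDl uea_mulDr uea1_neq0.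

Fact uea_scaleAl (c : K) u v : c *: (u * v) = (c *: u) * v.
Proof.
have [r <-] := upi_surj u; have [s <-] := upi_surj v.
by rewrite /GRing.mul /GRing.scale /= !E; apply/upiP; constructor.
Qed.
HB.instance Definition _ := GRing.Lmodule_isLalgebra.Build K (Uea g) uea_scaleAl.

Fact uea_scaleAr (c : K) u v : c *: (u * v) = u * (c *: v).
Proof.
have [r <-] := upi_surj u; have [s <-] := upi_surj v.
by rewrite /GRing.mul /GRing.scale /= !E; apply/upiP; constructor.
Qed.
HB.instance Definition _ := GRing.Lalgebra_isAlgebra.Build K (Uea g) uea_scaleAr.

Definition uin (x : g) : Uea g := upi (UGen x).

Lemma upiD s t : upi (UAdd s t) = upi s + upi t.
Proof. by rewrite -uea_addE. Qed.
Lemma upiZ c s : upi (UScale c s) = c *: upi s.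
Proof. by rewrite -uea_scaleE. Qed.
Lemma upiM s t : upi (UMul s t) = upi s * upi t.
Proof. by rewrite -uea_mulE. Qed.

Lemma uinD x y : uin (x + y) = uin x + uin y.
Proof. by rewrite -upiD; apply/upiP; constructor. Qed.
Lemma uinZ (c : K) x : uin (c *: x) = c *: uin x.
Proof. by rewrite -upiZ; apply/upiP; constructor. Qed.
Lemma uin_bracket b c x y : homog b x -> homog c y ->
  uin (bracket x y) = uin x * uin y - (-1) ^+ (b && c) *: (uin y * uin x).
Proof.
move=> hx hy; rewrite -scaleNr -!upiM -upiZ -upiD.
by apply/upiP; apply: UE_bracket.
Qed.

Lemma uea_ind (P : Uea g -> Prop) :
  (forall x, P (uin x)) -> P 0 -> P 1 -> (forall u v, P u -> P v -> P (u + v)) ->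
  (forall (c : K) u, P u -> P (c *: u)) -> (forall u v, P u -> P v -> P (u * v)) ->
  forall u, P u.
Proof.
move=> hg h0 h1 hD hZ hM u; have [t <-] := upi_surj u.
elim: t => [x| | |s hs t ht|c s hs|s hs t ht].
- exact: hg.
- exact: h0.
- exact: h1.
- by rewrite upiD; apply: hD.
- by rewrite upiZ; apply: hZ.
- by rewrite upiM; apply: hM.
Qed.

End UeaRing.

Section UeaMap.
Variables (K : numFieldType) (h g : lieSuperalgType K) (f : lieHom h g).

Fixpoint umap_term (t : uterm h) : uterm g :=
  match t with
  | UGen x => UGen (f x) | UZero => UZero | UOne => UOne
  | UAdd s t => UAdd (umap_term s) (umap_term t)
  | UScale c s => UScale c (umap_term s)
  | UMul s t => UMul (umap_term s) (umap_term t)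
  end.

Lemma umap_termP s t : ueq s t -> ueq (umap_term s) (umap_term t).
Proof.
elim=> /=; do ?by constructor.
- by move=> r r' t' _ h1 _ h2; apply: UE_trans h1 h2.
- by move=> x y; rewrite lieHomD; constructor.
- by move=> c x; rewrite lieHomZ; constructor.
- move=> b c x y hx hy; rewrite lieHom_bracket.
  by apply: UE_bracket; apply: lieHom_homog.
Qed.

(* The algebra morphism U(h) -> U(g) extending f.                            *)
Definition umap (u : Uea h) : Uea g := upi (umap_term (urep u)).

Lemma umapE t : umap (upi t) = upi (umap_term t).
Proof. by apply/upiP/umap_termP/urepP. Qed.
Lemma umap_gen x : umap (uin x) = uin (f x). Proof. exact: umapE. Qed.
Lemma umap0 : umap 0 = 0. Proof. exact: (umapE UZero). Qed.
Lemma umap1 : umap 1 = 1. Proof. exact: (umapE UOne). Qed.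
Lemma umapD u v : umap (u + v) = umap u + umap v.
Proof.
have [r <-] := upi_surj u; have [s <-] := upi_surj v.
by rewrite -upiD !umapE -upiD.
Qed.
Lemma umapZ (c : K) u : umap (c *: u) = c *: umap u.
Proof. by have [r <-] := upi_surj u; rewrite -upiZ !umapE -upiZ. Qed.
Lemma umapM u v : umap (u * v) = umap u * umap v.
Proof.
have [r <-] := upi_surj u; have [s <-] := upi_surj v.
by rewrite -upiM !umapE -upiM.
Qed.
End UeaMap.

Lemma umap_parity (K : numFieldType) (h g : lieSuperalgType K) (f : lieHom h g) u :
  umap (parityHom g) (umap f u) = umap f (umap (parityHom h) u).
Proof.
elim/uea_ind: u => [x| | |u v hu hv|c u hu|u v hu hv].
- by rewrite !umap_gen /= lieHom_parity.
- by rewrite !umap0.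
- by rewrite !umap1.
- by rewrite !umapD hu hv.
- by rewrite !umapZ hu.
- by rewrite !umapM hu hv.
Qed.

Section UeaAct.
Variables (K : numFieldType) (g : lieSuperalgType K) (V : lieSupermodType g).

Fixpoint uact_term (t : uterm g) (v : V) : V :=
  match t with
  | UGen x => act x v | UZero => 0 | UOne => v
  | UAdd s t => uact_term s v + uact_term t v
  | UScale c s => c *: uact_term s v
  | UMul s t => uact_term s (uact_term t v)
  end.

Lemma uact_term_lin t (c : K) u v :
  uact_term t (c *: u + v) = c *: uact_term t u + uact_term t v.
Proof.
elim: t c u v => [x| | |s hs t ht|d s hs|s hs t ht] c u v //=.
- by rewrite act_linr.
- by rewrite scaler0 addr0.
- by rewrite hs ht scalerDr addrACA.
- by rewrite hs scalerDr !scalerA mulrC.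
- by rewrite ht hs.
Qed.

Lemma uact_termP s t : ueq s t -> uact_term s =1 uact_term t.
Proof.
elim=> //=; do ?by move=> *; congruence.
- by move=> *; move=> ?; rewrite addrA.
- by move=> *; move=> ?; rewrite addrC.
- by move=> *; move=> ?; rewrite add0r.
- by move=> *; move=> ?; rewrite scaleN1r addNr.
- by move=> *; move=> ?; rewrite scalerA.
- by move=> *; move=> ?; rewrite scale1r.
- by move=> *; move=> ?; rewrite scalerDr.
- by move=> *; move=> ?; rewrite scalerDl.
- by move=> r1 r2 r3 v; have [-> _ _] := lin_D (uact_term_lin r1).
- by move=> c r1 r2 v; have [_ -> _] := lin_D (uact_term_lin r1).
- by move=> *; move=> ?; rewrite actDl.
- by move=> *; move=> ?; rewrite actZl.
- by move=> b c x y hx hy v; rewrite (act_bracket _ hx hy) scaleNr.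
Qed.

(* The action of U(g) on V extending that of g.                              *)
Definition uact (u : Uea g) (v : V) : V := uact_term (urep u) v.

Lemma uactE t v : uact (upi t) v = uact_term t v.
Proof. by apply: uact_termP; apply: urepP. Qed.
Lemma uact_gen x v : uact (uin x) v = act x v. Proof. exact: uactE. Qed.
Lemma uact0 v : uact 0 v = 0. Proof. exact: (uactE UZero). Qed.
Lemma uact1 v : uact 1 v = v. Proof. exact: (uactE UOne). Qed.
Lemma uactDl a b v : uact (a + b) v = uact a v + uact b v.
Proof.
have [r <-] := upi_surj a; have [s <-] := upi_surj b.
by rewrite -upiD !uactE.
Qed.
Lemma uactZl (c : K) a v : uact (c *: a) v = c *: uact a v.
Proof. by have [r <-] := upi_surj a; rewrite -upiZ !uactE. Qed.
Lemma uactM a b v : uact (a * b) v = uact a (uact b v).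
Proof.
have [r <-] := upi_surj a; have [s <-] := upi_surj b.
by rewrite -upiM !uactE.
Qed.
Lemma uact_lin a (c : K) u v : uact a (c *: u + v) = c *: uact a u + uact a v.
Proof. exact: uact_term_lin. Qed.

Lemma parity_uact a v : parity (uact a v) = uact (umap (parityHom g) a) (parity v).
Proof.
have [pD pZ p0] := lin_D (@parity_lin K V).
elim/uea_ind: a v => [x| | |a b ha hb|c a ha|a b ha hb] v.
- by rewrite umap_gen !uact_gen parity_act.
- by rewrite umap0 !uact0 p0.
- by rewrite umap1 !uact1.
- by rewrite umapD !uactDl pD ha hb.
- by rewrite umapZ !uactZl pZ ha.
- by rewrite umapM !uactM ha hb.
Qed.
End UeaAct.

(* The Z_2-grading of U(g) inherited from g.                                 *)
Inductive uea_homog (K : numFieldType) (g : lieSuperalgType K) :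
    bool -> Uea g -> Prop :=
| UH_gen b x : homog b x -> uea_homog b (uin x)
| UH_one : uea_homog false 1
| UH_zero b : uea_homog b 0
| UH_lin b (c : K) u v :
    uea_homog b u -> uea_homog b v -> uea_homog b (c *: u + v)
| UH_mul b c u v :
    uea_homog b u -> uea_homog c v -> uea_homog (b (+) c) (u * v).

Section UeaSuper.
Variables (K : numFieldType) (g : lieSuperalgType K).
Implicit Types u v : Uea g.

Lemma uea_homog_parity b u : uea_homog b u ->
  umap (parityHom g) u = (-1) ^+ b *: u.
Proof.
elim=> {b u} [b x hx||b|b c u v _ hu _ hv|b c u v _ hu _ hv].
- by rewrite umap_gen /= (parity_homog hx) uinZ.
- by rewrite umap1 expr0 scale1r.
- by rewrite umap0 scaler0.
- by rewrite umapD umapZ hu hv scalerDr !scalerA mulrC.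
- by rewrite umapM hu hv -scalerAl -scalerAr scalerA signr_addb.
Qed.

Lemma uea_homogD b u v : uea_homog b u -> uea_homog b v -> uea_homog b (u + v).
Proof. by move=> hu hv; rewrite -[u]scale1r; apply: UH_lin. Qed.

Fact uea_homog_dec u :
  exists u0 u1, [/\ uea_homog false u0, uea_homog true u1 & u = u0 + u1].
Proof.
elim/uea_ind: u => [x| | |u v|c u|u v].
- have [x0 [x1 [h0 h1 ->]]] := homog_dec x.
  by exists (uin x0), (uin x1); split; rewrite ?uinD //; apply: UH_gen.
- by exists 0, 0; split; rewrite ?addr0 //; apply: UH_zero.
- by exists 1, 0; split; rewrite ?addr0 //; [apply: UH_one|apply: UH_zero].
- move=> [u0 [u1 [h0 h1 ->]]] [v0 [v1 [k0 k1 ->]]]; exists (u0 + v0), (u1 + v1).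
  by split; rewrite 1?addrACA //; apply: uea_homogD.
- move=> [u0 [u1 [h0 h1 ->]]]; exists (c *: u0), (c *: u1).
  split; rewrite ?scalerDr // -[_ *: _]addr0; apply: UH_lin => //; exact: UH_zero.
- move=> [u0 [u1 [h0 h1 ->]]] [v0 [v1 [k0 k1 ->]]].
  exists (u0 * v0 + u1 * v1), (u0 * v1 + u1 * v0); split.
  + by apply: uea_homogD; [exact: (UH_mul h0 k0)|exact: (UH_mul h1 k1)].
  + by apply: uea_homogD; [exact: (UH_mul h0 k1)|exact: (UH_mul h1 k0)].
  + rewrite mulrDl !mulrDr [u1 * v0 + _]addrC addrACA.
    by [].
Qed.

Fact uea_homog_cap u : uea_homog false u -> uea_homog true u -> u = 0.
Proof.
move=> /uea_homog_parity h0 /uea_homog_parity.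
by rewrite h0 expr0 expr1 scale1r scaleN1r; apply: sg2_eq0.
Qed.

HB.instance Definition _ := Lmodule_isSuperspace.Build K (Uea g)
  (@UH_zero K g) (@UH_lin K g) uea_homog_dec uea_homog_cap.
End UeaSuper.

(* Induction along f : h -> g, that is U(g) (x)_U(h) M with U(g) a right      *)
(* U(h)-module through U(f): formal linear combinations of symbols u (x) m    *)
(* modulo K-bilinearity and u U(f)(b) (x) m = u (x) b m for b in U(h).        *)

Section IndTerm.
Variables (K : numFieldType) (h g : lieSuperalgType K) (f : lieHom h g).
Variable M : lieSupermodType h.

Inductive iterm :=
| ITens of Uea g & M
| IZero
| IAdd of iterm & iterm
| IScale of K & iterm.

Inductive ieq : iterm -> iterm -> Prop :=
| IE_refl s : ieq s s
| IE_sym s t : ieq s t -> ieq t s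
| IE_trans s t r : ieq s t -> ieq t r -> ieq s r
| IE_add s s' t t' : ieq s s' -> ieq t t' -> ieq (IAdd s t) (IAdd s' t')
| IE_scale c s s' : ieq s s' -> ieq (IScale c s) (IScale c s')
| IE_addA r s t : ieq (IAdd r (IAdd s t)) (IAdd (IAdd r s) t)
| IE_addC s t : ieq (IAdd s t) (IAdd t s)
| IE_add0 s : ieq (IAdd IZero s) s
| IE_addN s : ieq (IAdd (IScale (-1) s) s) IZero
| IE_scaleA a b s : ieq (IScale a (IScale b s)) (IScale (a * b) s)
| IE_scale1 s : ieq (IScale 1 s) s
| IE_scaleDr a s t : ieq (IScale a (IAdd s t)) (IAdd (IScale a s) (IScale a t))
| IE_scaleDl a b s : ieq (IScale (a + b) s) (IAdd (IScale a s) (IScale b s))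
| IE_tensDl u v m : ieq (ITens (u + v) m) (IAdd (ITens u m) (ITens v m))
| IE_tensDr u m n : ieq (ITens u (m + n)) (IAdd (ITens u m) (ITens u n))
| IE_tensZl c u m : ieq (ITens (c *: u) m) (IScale c (ITens u m))
| IE_tensZr c u m : ieq (ITens u (c *: m)) (IScale c (ITens u m))
| IE_balance u (b : Uea h) m :
    ieq (ITens (u * umap f b) m) (ITens u (uact b m)).

HB.instance Definition _ := gen_eqMixin iterm.
HB.instance Definition _ := gen_choiceMixin iterm.

Definition Ind := cq IE_refl IE_sym IE_trans.

HB.instance Definition _ := Choice.on Ind.

Definition ipi : iterm -> Ind := cq_pi _ _ _.
Definition irep : Ind -> iterm := repr.

Lemma ipiP s t : ipi s = ipi t <-> ieq s t. Proof. exact: cq_piP. Qed.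
Lemma ipi_surj u : exists s, ipi s = u. Proof. exact: cq_surj. Qed.
Lemma irepP s : ieq (irep (ipi s)) s. Proof. exact: cq_repr. Qed.

Definition ind_add u v := ipi (IAdd (irep u) (irep v)).
Definition ind_scale c u := ipi (IScale c (irep u)).

Lemma ind_addE s t : ind_add (ipi s) (ipi t) = ipi (IAdd s t).
Proof. by apply/ipiP; apply: IE_add; apply: irepP. Qed.
Lemma ind_scaleE c s : ind_scale c (ipi s) = ipi (IScale c s).
Proof. by apply/ipiP; apply: IE_scale; apply: irepP. Qed.

Let E := (ind_addE, ind_scaleE).

Fact ind_addA : associative ind_add.
Proof.
move=> u v w; have [r <-] := ipi_surj u; have [s <-] := ipi_surj v.
by have [t <-] := ipi_surj w; rewrite !E; apply/ipiP; constructor.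
Qed.
Fact ind_addC : commutative ind_add.
Proof.
move=> u v; have [r <-] := ipi_surj u; have [s <-] := ipi_surj v.
by rewrite !E; apply/ipiP; constructor.
Qed.
Fact ind_add0 : left_id (ipi IZero) ind_add.
Proof. by move=> u; have [r <-] := ipi_surj u; rewrite !E; apply/ipiP; constructor. Qed.
Fact ind_addN : left_inverse (ipi IZero) (ind_scale (-1)) ind_add.
Proof. by move=> u; have [r <-] := ipi_surj u; rewrite !E; apply/ipiP; constructor. Qed.

HB.instance Definition _ :=
  GRing.isZmodule.Build Ind ind_addA ind_addC ind_add0 ind_addN.

Fact ind_scaleA a b u : ind_scale a (ind_scale b u) = ind_scale (a * b) u.
Proof. by have [r <-] := ipi_surj u; rewrite !E; apply/ipiP; constructor. Qed.
Fact ind_scale1 : left_id 1 ind_scale.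
Proof. by move=> u; have [r <-] := ipi_surj u; rewrite !E; apply/ipiP; constructor. Qed.
Fact ind_scaleDr : right_distributive ind_scale +%R.
Proof.
move=> a u v; have [r <-] := ipi_surj u; have [s <-] := ipi_surj v.
by rewrite /GRing.add /= !E; apply/ipiP; constructor.
Qed.
Fact ind_scaleDl u : {morph ind_scale^~ u : a b / a + b}.
Proof.
move=> a b; have [r <-] := ipi_surj u.
by rewrite {2}/GRing.add /= !E; apply/ipiP; constructor.
Qed.

HB.instance Definition _ := GRing.Zmodule_isLmodule.Build K Ind
  ind_scaleA ind_scale1 ind_scaleDr ind_scaleDl.

Definition tens (u : Uea g) (m : M) : Ind := ipi (ITens u m).

Lemma ipiD s t : ipi (IAdd s t) = ipi s + ipi t.
Proof. by rewrite -ind_addE. Qed.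
Lemma ipiZ c s : ipi (IScale c s) = c *: ipi s.
Proof. by rewrite -ind_scaleE. Qed.
Lemma tensDl u v m : tens (u + v) m = tens u m + tens v m.
Proof. by rewrite -ipiD; apply/ipiP; constructor. Qed.
Lemma tensDr u m n : tens u (m + n) = tens u m + tens u n.
Proof. by rewrite -ipiD; apply/ipiP; constructor. Qed.
Lemma tensZl (c : K) u m : tens (c *: u) m = c *: tens u m.
Proof. by rewrite -ipiZ; apply/ipiP; constructor. Qed.
Lemma tensZr (c : K) u m : tens u (c *: m) = c *: tens u m.
Proof. by rewrite -ipiZ; apply/ipiP; constructor. Qed.
Lemma tens_balance u b m : tens (u * umap f b) m = tens u (uact b m).
Proof. by apply/ipiP; constructor. Qed.

Lemma ind_ind (P : Ind -> Prop) : (forall u m, P (tens u m)) -> P 0 ->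
  (forall u v, P u -> P v -> P (u + v)) -> (forall (c : K) u, P u -> P (c *: u)) ->
  forall u, P u.
Proof.
move=> hg h0 hD hZ u; have [t <-] := ipi_surj u.
elim: t => [x m| |s hs t ht|c s hs].
- exact: hg.
- exact: h0.
- by rewrite ipiD; apply: hD.
- by rewrite ipiZ; apply: hZ.
Qed.

Section IndMap.
Variables (F : Uea g -> Uea g) (G : M -> M).

Fixpoint imap_term (t : iterm) : iterm :=
  match t with
  | ITens u m => ITens (F u) (G m) | IZero => IZero
  | IAdd s t => IAdd (imap_term s) (imap_term t)
  | IScale c s => IScale c (imap_term s)
  end.

Definition imap (x : Ind) : Ind := ipi (imap_term (irep x)).

Hypothesis F_lin : forall (c : K) u v, F (c *: u + v) = c *: F u + F v.
Hypothesis G_lin : forall (c : K) m n, G (c *: m + n) = c *: G m + G n.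
Hypothesis FG : forall u b m, ieq (ITens (F (u * umap f b)) (G m))
                                  (ITens (F u) (G (uact b m))).

Lemma imap_termP s t : ieq s t -> ieq (imap_term s) (imap_term t).
Proof.
have [FD FZ _] := lin_D F_lin; have [GD GZ _] := lin_D G_lin.
elim=> /=; do ?by constructor.
- by move=> r r' t' _ h1 _ h2; apply: IE_trans h1 h2.
- by move=> *; rewrite FD; constructor.
- by move=> *; rewrite GD; constructor.
- by move=> *; rewrite FZ; constructor.
- by move=> *; rewrite GZ; constructor.
- by move=> *; apply: FG.
Qed.

Lemma imapE t : imap (ipi t) = ipi (imap_term t).
Proof. by apply/ipiP/imap_termP/irepP. Qed.
Lemma imap_tens u m : imap (tens u m) = tens (F u) (G m).
Proof. exact: imapE. Qed.
Lemma imap_lin (c : K) x y : imap (c *: x + y) = c *: imap x + imap y.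
Proof.
have [r <-] := ipi_surj x; have [s <-] := ipi_surj y.
by rewrite -ipiZ -ipiD !imapE -ipiZ -ipiD.
Qed.
End IndMap.

Definition ind_lmul (a : Uea g) : Ind -> Ind := imap (fun u => a * u) id.

Lemma ind_lmul_tens a u m : ind_lmul a (tens u m) = tens (a * u) m.
Proof.
apply: imap_tens => // [c v w|v b n]; first by rewrite mulrDr scalerAr.
by rewrite mulrA; constructor.
Qed.
Lemma ind_lmul_lin a (c : K) x y :
  ind_lmul a (c *: x + y) = c *: ind_lmul a x + ind_lmul a y.
Proof.
apply: imap_lin => // [d v w|v b n]; first by rewrite mulrDr scalerAr.
by rewrite mulrA; constructor.
Qed.

Lemma ind_lmulDl a b x : ind_lmul (a + b) x = ind_lmul a x + ind_lmul b x.
Proof.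
have [aD aZ a0] := lin_D (ind_lmul_lin a); have [bD bZ b0] := lin_D (ind_lmul_lin b).
have [cD cZ c0] := lin_D (ind_lmul_lin (a + b)).
elim/ind_ind: x => [u m| |x y hx hy|c x hx].
- by rewrite !ind_lmul_tens mulrDl tensDl.
- by rewrite a0 b0 c0 addr0.
- by rewrite aD bD cD hx hy addrACA.
- by rewrite aZ bZ cZ hx scalerDr.
Qed.

Lemma ind_lmulZl (d : K) a x : ind_lmul (d *: a) x = d *: ind_lmul a x.
Proof.
have [aD aZ a0] := lin_D (ind_lmul_lin a).
have [cD cZ c0] := lin_D (ind_lmul_lin (d *: a)).
elim/ind_ind: x => [u m| |x y hx hy|c x hx].
- by rewrite !ind_lmul_tens -scalerAl tensZl.
- by rewrite a0 c0 scaler0.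
- by rewrite aD cD hx hy scalerDr.
- by rewrite aZ cZ hx !scalerA mulrC.
Qed.

Lemma ind_lmulM a b x : ind_lmul (a * b) x = ind_lmul a (ind_lmul b x).
Proof.
have [aD aZ a0] := lin_D (ind_lmul_lin a); have [bD bZ b0] := lin_D (ind_lmul_lin b).
have [cD cZ c0] := lin_D (ind_lmul_lin (a * b)).
elim/ind_ind: x => [u m| |x y hx hy|c x hx].
- by rewrite !ind_lmul_tens mulrA.
- by rewrite b0 a0 c0.
- by rewrite cD bD aD hx hy.
- by rewrite cZ bZ aZ hx.
Qed.

Inductive ind_homog : bool -> Ind -> Prop :=
| IH_tens b c u m : homog b u -> homog c m -> ind_homog (b (+) c) (tens u m)
| IH_zero b : ind_homog b 0
| IH_lin b (c : K) x y :
    ind_homog b x -> ind_homog b y -> ind_homog b (c *: x + y).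

Definition ind_parity := imap (umap (parityHom g)) (@parity K M).

Lemma ind_parity_hyps :
  [/\ forall (c : K) u v, umap (parityHom g) (c *: u + v) =
        c *: umap (parityHom g) u + umap (parityHom g) v
    & forall u b m,
        ieq (ITens (umap (parityHom g) (u * umap f b)) (parity m))
            (ITens (umap (parityHom g) u) (parity (uact b m)))].
Proof.
split=> [c u v|u b m]; first by rewrite umapD umapZ.
by rewrite umapM umap_parity parity_uact; constructor.
Qed.

Lemma ind_homog_parity b x : ind_homog b x -> ind_parity x = (-1) ^+ b *: x.
Proof.
have [h1 h2] := ind_parity_hyps; have h3 := @parity_lin K M.
have [pD pZ p0] := lin_D (imap_lin h1 h3 h2).
elim=> {b x} [b c u m hu hm|b|b c x y _ hx _ hy].
- rewrite /ind_parity imap_tens // (uea_homog_parity hu) (parity_homog hm).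
  by rewrite tensZl tensZr scalerA signr_addb.
- by rewrite /ind_parity p0 scaler0.
- by rewrite /ind_parity pD pZ -/ind_parity hx hy scalerDr !scalerA mulrC.
Qed.

Lemma ind_homogD b u v : ind_homog b u -> ind_homog b v -> ind_homog b (u + v).
Proof. by move=> hu hv; rewrite -[u]scale1r; apply: IH_lin. Qed.

Fact ind_homog_dec u :
  exists u0 u1, [/\ ind_homog false u0, ind_homog true u1 & u = u0 + u1].
Proof.
elim/ind_ind: u => [u m| |u v|c u].
- have [u0 [u1 [h0 h1 ->]]] := homog_dec u; have [v0 [v1 [k0 k1 ->]]] := homog_dec m.
  exists (tens u0 v0 + tens u1 v1), (tens u0 v1 + tens u1 v0); split.
  + by apply: ind_homogD; [exact: (IH_tens h0 k0)|exact: (IH_tens h1 k1)].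
  + by apply: ind_homogD; [exact: (IH_tens h0 k1)|exact: (IH_tens h1 k0)].
  + by rewrite tensDl !tensDr [tens u1 v0 + _]addrC addrACA.
- by exists 0, 0; split; rewrite ?addr0 //; apply: IH_zero.
- move=> [u0 [u1 [h0 h1 ->]]] [v0 [v1 [k0 k1 ->]]]; exists (u0 + v0), (u1 + v1).
  by split; rewrite 1?addrACA //; apply: ind_homogD.
- move=> [u0 [u1 [h0 h1 ->]]]; exists (c *: u0), (c *: u1).
  split; rewrite ?scalerDr // -[_ *: _]addr0; apply: IH_lin => //; exact: IH_zero.
Qed.

Fact ind_homog_cap u : ind_homog false u -> ind_homog true u -> u = 0.
Proof.
move=> /ind_homog_parity h0 /ind_homog_parity.
by rewrite h0 expr0 expr1 scale1r scaleN1r; apply: sg2_eq0.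
Qed.

HB.instance Definition _ := Lmodule_isSuperspace.Build K Ind
  IH_zero IH_lin ind_homog_dec ind_homog_cap.

Definition ind_act (x : g) : Ind -> Ind := ind_lmul (uin x).

Fact ind_act_linl (c : K) x y v :
  ind_act (c *: x + y) v = c *: ind_act x v + ind_act y v.
Proof. by rewrite /ind_act uinD uinZ ind_lmulDl ind_lmulZl. Qed.

Fact ind_act_linr (c : K) x u v :
  ind_act x (c *: u + v) = c *: ind_act x u + ind_act x v.
Proof. exact: ind_lmul_lin. Qed.

Fact ind_act_homog b c x v :
  homog b x -> homog c v -> homog (b (+) c) (ind_act x v).
Proof.
move=> hx; have [aD aZ a0] := lin_D (ind_lmul_lin (uin x)).
elim=> {c v} [c d u m hu hm|c|c d u v _ hu _ hv].
- rewrite /ind_act ind_lmul_tens addbA; apply: IH_tens => //.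
  by apply: UH_mul => //; apply: UH_gen.
- by rewrite /ind_act a0; apply: IH_zero.
- by rewrite ind_act_linr; apply: IH_lin.
Qed.

Fact ind_act_bracket b c x y v : homog b x -> homog c y ->
  ind_act (bracket x y) v =
    ind_act x (ind_act y v) - (-1) ^+ (b && c) *: ind_act y (ind_act x v).
Proof.
move=> hx hy; rewrite /ind_act (uin_bracket hx hy) -scaleNr.
by rewrite ind_lmulDl ind_lmulZl !ind_lmulM scaleNr.
Qed.

HB.instance Definition _ := Superspace_isLieSupermodule.Build K g Ind
  ind_act_linl ind_act_linr ind_act_homog ind_act_bracket.

End IndTerm.

Record subsupermod (K : numFieldType) (g : lieSuperalgType K)
    (V : lieSupermodType g) := SubSupermod {
  subsm_set :> set V;
  subsm0 : subsm_set 0;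
  subsm_lin : forall (c : K) u v,
    subsm_set u -> subsm_set v -> subsm_set (c *: u + v);
  subsm_act : forall (x : g) v, subsm_set v -> subsm_set (act x v);
  subsm_graded : forall v, subsm_set v -> exists v0 v1,
    [/\ homog false v0 /\ subsm_set v0, homog true v1 /\ subsm_set v1
      & v = v0 + v1]
}.

Definition irreducible_supermod (K : numFieldType) (g : lieSuperalgType K)
    (V : lieSupermodType g) : Prop :=
  (exists v : V, v <> 0) /\
  forall N : subsupermod V, N = [set 0] :> set V \/ N = setT :> set V.

(* U(g) v *)
Definition usubmod (K : numFieldType) (g : lieSuperalgType K)
    (V : lieSupermodType g) (v : V) : set V := range (fun u : Uea g => uact u v).

Section Cyclic.
Variables (K : numFieldType) (g : lieSuperalgType K) (V : lieSupermodType g).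
Variables (b : bool) (v : V) (hv : homog b v).

Fact cyclic0 : usubmod v 0. Proof. by exists 0 => //; rewrite uact0. Qed.
Fact cyclic_lin (c : K) u w : usubmod v u -> usubmod v w -> usubmod v (c *: u + w).
Proof.
by move=> [r _ <-] [s _ <-]; exists (c *: r + s) => //; rewrite uactDl uactZl.
Qed.
Fact cyclic_act (x : g) u : usubmod v u -> usubmod v (act x u).
Proof. by move=> [r _ <-]; exists (uin x * r) => //; rewrite uactM uact_gen. Qed.

Lemma uact_homog c u w d : uea_homog c u -> homog d w ->
  homog (c (+) d) (uact u w : V).
Proof.
move=> hu; elim: hu w d => {c u} [c x hx||c|c a u u' _ hu _ hu'|c c' u u' _ hu _ hu'] w d hw.
- by rewrite uact_gen; apply: act_homog.
- by rewrite uact1 addFb.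
- by rewrite uact0; apply: homog0.
- by rewrite uactDl uactZl; apply: homogP; [apply: hu|apply: hu'].
- by rewrite uactM -addbA; apply/hu/hu'.
Qed.

Fact cyclic_graded u : usubmod v u -> exists v0 v1,
  [/\ homog false v0 /\ usubmod v v0, homog true v1 /\ usubmod v v1 & u = v0 + v1].
Proof.
move=> [r _ <-]; have [r0 [r1 [h0 h1 ->]]] := uea_homog_dec r; rewrite uactDl.
have k0 := uact_homog h0 hv; have k1 := uact_homog h1 hv.
have i0 : usubmod v (uact r0 v) by exists r0.
have i1 : usubmod v (uact r1 v) by exists r1.
case: (b) k0 k1 => /= k0 k1; last by exists (uact r0 v), (uact r1 v).
by exists (uact r1 v), (uact r0 v); split=> //; rewrite addrC.
Qed.

Definition cyclic : subsupermod V :=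
  SubSupermod cyclic0 cyclic_lin cyclic_act cyclic_graded.
End Cyclic.

Section QuotientModule.
Variables (K : numFieldType) (g : lieSuperalgType K) (V : lieSupermodType g).
Variable N : subsupermod V.

Lemma subsmD u v : subsm_set N u -> subsm_set N v -> subsm_set N (u + v).
Proof. by move=> hu hv; rewrite -[u]scale1r; apply: subsm_lin. Qed.
Lemma subsmZ (c : K) u : subsm_set N u -> subsm_set N (c *: u).
Proof. by move=> hu; rewrite -[_ *: _]addr0; apply: subsm_lin => //; apply: subsm0. Qed.

Definition qrel (u v : V) : Prop := subsm_set N (u - v).
Fact qrel_refl u : qrel u u. Proof. by rewrite /qrel subrr; apply: subsm0. Qed.
Fact qrel_sym u v : qrel u v -> qrel v u.
Proof. by rewrite /qrel -opprB -scaleN1r => /(subsmZ (-1)); rewrite scalerA mulrNN mul1r scale1r. Qed.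
Fact qrel_trans u v w : qrel u v -> qrel v w -> qrel u w.
Proof. by rewrite /qrel => h1 h2; rewrite -(subrKA v); apply: subsmD. Qed.

Definition quot := cq qrel_refl qrel_sym qrel_trans.
HB.instance Definition _ := Choice.on quot.

Definition qpi : V -> quot := cq_pi _ _ _.
Definition qrep : quot -> V := repr.

Lemma qpiP u v : qpi u = qpi v <-> subsm_set N (u - v). Proof. exact: cq_piP. Qed.
Lemma qpi_surj q : exists v, qpi v = q. Proof. exact: cq_surj. Qed.
Lemma qrepP v : subsm_set N (qrep (qpi v) - v).
Proof. exact: (cq_repr qrel_refl qrel_sym qrel_trans v). Qed.

Definition quot_add p q := qpi (qrep p + qrep q).
Definition quot_scale (c : K) q := qpi (c *: qrep q).
Definition quot_act (x : g) q := qpi (act x (qrep q)).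

Lemma quot_addE u v : quot_add (qpi u) (qpi v) = qpi (u + v).
Proof. by apply/qpiP; rewrite opprD addrACA; apply: subsmD; apply: qrepP. Qed.
Lemma quot_scaleE c u : quot_scale c (qpi u) = qpi (c *: u).
Proof. by apply/qpiP; rewrite -scalerBr; apply: subsmZ; apply: qrepP. Qed.
Lemma quot_actE x u : quot_act x (qpi u) = qpi (act x u).
Proof.
apply/qpiP; rewrite -scaleN1r -actZr -actDr scaleN1r.
by apply: subsm_act; apply: qrepP.
Qed.

Let E := (quot_addE, quot_scaleE, quot_actE).

Fact quot_addA : associative quot_add.
Proof.
move=> u v w; have [r <-] := qpi_surj u; have [s <-] := qpi_surj v.
by have [t <-] := qpi_surj w; rewrite !E addrA.
Qed.
Fact quot_addC : commutative quot_add.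
Proof.
by move=> u v; have [r <-] := qpi_surj u; have [s <-] := qpi_surj v; rewrite !E addrC.
Qed.
Fact quot_add0 : left_id (qpi 0) quot_add.
Proof. by move=> u; have [r <-] := qpi_surj u; rewrite !E add0r. Qed.
Fact quot_addN : left_inverse (qpi 0) (quot_scale (-1)) quot_add.
Proof. by move=> u; have [r <-] := qpi_surj u; rewrite !E scaleN1r addNr. Qed.

HB.instance Definition _ :=
  GRing.isZmodule.Build quot quot_addA quot_addC quot_add0 quot_addN.

Fact quot_scaleA a b u : quot_scale a (quot_scale b u) = quot_scale (a * b) u.
Proof. by have [r <-] := qpi_surj u; rewrite !E scalerA. Qed.
Fact quot_scale1 : left_id 1 quot_scale.
Proof. by move=> u; have [r <-] := qpi_surj u; rewrite !E scale1r. Qed.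
Fact quot_scaleDr : right_distributive quot_scale +%R.
Proof.
move=> a u v; have [r <-] := qpi_surj u; have [s <-] := qpi_surj v.
by rewrite [LHS]/quot_scale /GRing.add /= -/(quot_scale _ _) !E scalerDr.
Qed.
Fact quot_scaleDl u : {morph quot_scale^~ u : a b / a + b}.
Proof.
move=> a b; have [r <-] := qpi_surj u.
by rewrite {2}/GRing.add /= !E scalerDl.
Qed.

HB.instance Definition _ := GRing.Zmodule_isLmodule.Build K quot
  quot_scaleA quot_scale1 quot_scaleDr quot_scaleDl.

Lemma qpi_lin (c : K) u v : qpi (c *: u + v) = c *: qpi u + qpi v.
Proof. by rewrite -quot_addE -quot_scaleE. Qed.

Definition quot_homog (b : bool) : set quot := qpi @` homog b.

Fact quot_homog0 b : quot_homog b 0.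
Proof. by exists 0 => //; apply: homog0. Qed.
Fact quot_homogP b (c : K) p q :
  quot_homog b p -> quot_homog b q -> quot_homog b (c *: p + q).
Proof.
move=> [u hu <-] [v hv <-]; exists (c *: u + v); first exact: homogP.
exact: qpi_lin.
Qed.
Fact quot_homog_dec q :
  exists q0 q1, [/\ quot_homog false q0, quot_homog true q1 & q = q0 + q1].
Proof.
have [v <-] := qpi_surj q; have [v0 [v1 [h0 h1 ->]]] := homog_dec v.
exists (qpi v0), (qpi v1); split; [by exists v0|by exists v1|].
by have [-> _ _] := lin_D qpi_lin.
Qed.
Fact quot_homog_cap q : quot_homog false q -> quot_homog true q -> q = 0.
Proof.
move=> [v0 h0 <-] [v1 h1 /qpiP /subsm_graded [n0 [n1 [[k0 i0] [k1 i1]]]]].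
rewrite addrC => e; have [e0 _] := homog_uniq (homogN h0) k0 h1 k1 e.
apply/qpiP; rewrite subr0 -[v0]opprK e0 -scaleN1r; exact: subsmZ.
Qed.

HB.instance Definition _ := Lmodule_isSuperspace.Build K quot
  quot_homog0 quot_homogP quot_homog_dec quot_homog_cap.

Fact quot_act_linl (c : K) x y q :
  quot_act (c *: x + y) q = c *: quot_act x q + quot_act y q.
Proof. by have [v <-] := qpi_surj q; rewrite !E act_linl qpi_lin. Qed.
Fact quot_act_linr (c : K) x p q :
  quot_act x (c *: p + q) = c *: quot_act x p + quot_act x q.
Proof.
have [u <-] := qpi_surj p; have [v <-] := qpi_surj q.
by rewrite -qpi_lin !E act_linr qpi_lin.
Qed.
Fact quot_act_homog b c x q :
  homog b x -> homog c q -> homog (b (+) c) (quot_act x q).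
Proof.
move=> hx [v hv <-]; rewrite E; exists (act x v) => //; exact: act_homog.
Qed.
Fact quot_act_bracket b c x y q : homog b x -> homog c y ->
  quot_act (bracket x y) q =
    quot_act x (quot_act y q) - (-1) ^+ (b && c) *: quot_act y (quot_act x q).
Proof.
move=> hx hy; have [v <-] := qpi_surj q.
by rewrite !E (act_bracket _ hx hy) -scaleNr addrC qpi_lin scaleNr addrC.
Qed.

HB.instance Definition _ := Superspace_isLieSupermodule.Build K g quot
  quot_act_linl quot_act_linr quot_act_homog quot_act_bracket.
End QuotientModule.

Definition pshift (K : numFieldType) (g : lieSuperalgType K)
  (V : lieSupermodType g) : Type := V.

Section ParityShift.
Variables (K : numFieldType) (g : lieSuperalgType K) (V : lieSupermodType g).

HB.instance Definition _ := GRing.Lmodule.on (pshift V).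

Definition pshift_homog (b : bool) : set (pshift V) := @homog K V (~~ b).

Fact pshift_homog0 b : pshift_homog b 0. Proof. exact: (@homog0 K V). Qed.
Fact pshift_homogP b (c : K) (u v : pshift V) :
  pshift_homog b u -> pshift_homog b v -> pshift_homog b (c *: u + v).
Proof. exact: (@homogP K V). Qed.
Fact pshift_homog_dec (v : pshift V) : exists v0 v1,
  [/\ pshift_homog false v0, pshift_homog true v1 & v = v0 + v1].
Proof.
have [v0 [v1 [h0 h1 e]]] := @homog_dec K V v.
by exists v1, v0; split=> //; rewrite addrC.
Qed.
Fact pshift_homog_cap (v : pshift V) :
  pshift_homog false v -> pshift_homog true v -> v = 0.
Proof. by move=> h1 h0; apply: (@homog_cap K V). Qed.

HB.instance Definition _ := Lmodule_isSuperspace.Build K (pshift V)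
  pshift_homog0 pshift_homogP pshift_homog_dec pshift_homog_cap.

Definition pshift_act (x : g) (v : pshift V) : pshift V := @act K g V x v.

Fact pshift_act_homog b c x v :
  homog b x -> homog c v -> homog (b (+) c) (pshift_act x v).
Proof. by move=> hx hv; have := @act_homog K g V _ _ _ _ hx hv; rewrite addbN. Qed.

HB.instance Definition _ := Superspace_isLieSupermodule.Build K g (pshift V)
  (@act_linl K g V) (@act_linr K g V) pshift_act_homog (@act_bracket K g V).
End ParityShift.

Definition supermod_iso (K : numFieldType) (g : lieSuperalgType K)
    (V W : lieSupermodType g) : Prop :=
  exists f : V -> W, [/\ linear f, bijective f,
    forall b v, homog b v -> homog b (f v)
    & forall (x : g) v, f (act x v) = act x (f v)].

Definition iso_up_to_parity (K : numFieldType) (g : lieSuperalgType K)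
    (V W : lieSupermodType g) : Prop :=
  supermod_iso V W \/ supermod_iso V (pshift W : lieSupermodType g).

Record lieIdeal (K : numFieldType) (g : lieSuperalgType K) := LieIdeal {
  ideal_set :> set g;
  ideal0 : ideal_set 0;
  ideal_lin : forall (c : K) x y,
    ideal_set x -> ideal_set y -> ideal_set (c *: x + y);
  ideal_graded : forall x, ideal_set x -> exists x0 x1,
    [/\ homog false x0 /\ ideal_set x0, homog true x1 /\ ideal_set x1
      & x = x0 + x1];
  ideal_bracket : forall x y, ideal_set y -> ideal_set (bracket x y)
}.

Definition ideal_pred (K : numFieldType) (g : lieSuperalgType K) (p : lieIdeal g)
  : {pred g} := fun x => `[< ideal_set p x >].

(* An ideal as a Lie superalgebra in its own right.                          *)
Record ideal_type (K : numFieldType) (g : lieSuperalgType K) (p : lieIdeal g) :=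
  IdealElt { ideal_val :> g; _ : ideal_val \in ideal_pred p }.

Section IdealType.
Variables (K : numFieldType) (g : lieSuperalgType K) (p : lieIdeal g).

HB.instance Definition _ := [isSub for @ideal_val K g p].
HB.instance Definition _ := [Choice of ideal_type p by <:].

Fact ideal_submod_closed : submod_closed (ideal_pred p).
Proof.
split; first exact/asboolP/ideal0.
by move=> c x y /asboolP hx /asboolP hy; apply/asboolP/ideal_lin.
Qed.
HB.instance Definition _ := GRing.isSubmodClosed.Build K g (ideal_pred p)
  ideal_submod_closed.
HB.instance Definition _ := [SubChoice_isSubLmodule of ideal_type p by <:].

Lemma ideal_valP (x : ideal_type p) : ideal_set p (ideal_val x).
Proof. by apply/asboolP; case: x. Qed.

Definition ideal_in (x : g) (hx : ideal_set p x) : ideal_type p := IdealElt (introT (asboolP _) hx).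

Lemma ideal_val_inj : injective (@ideal_val K g p). Proof. exact: val_inj. Qed.

Definition it_homog (b : bool) : set (ideal_type p) := [set x | homog b (ideal_val x)].

Fact it_homog0 b : it_homog b 0. Proof. exact: homog0. Qed.
Fact it_homogP b (c : K) x y : it_homog b x -> it_homog b y -> it_homog b (c *: x + y).
Proof. exact: homogP. Qed.
Fact it_homog_dec x :
  exists x0 x1, [/\ it_homog false x0, it_homog true x1 & x = x0 + x1].
Proof.
have [x0 [x1 [[h0 i0] [h1 i1] e]]] := ideal_graded (ideal_valP x).
by exists (ideal_in i0), (ideal_in i1); split=> //; apply: ideal_val_inj.
Qed.
Fact it_homog_cap x : it_homog false x -> it_homog true x -> x = 0.
Proof. by move=> h0 h1; apply: ideal_val_inj; apply: homog_cap. Qed.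

HB.instance Definition _ := Lmodule_isSuperspace.Build K (ideal_type p)
  it_homog0 it_homogP it_homog_dec it_homog_cap.

(* [y, x] as an element of p, for y in g and x in p. *)
Definition ad_ideal (y : g) (x : ideal_type p) : ideal_type p :=
  ideal_in (ideal_bracket y (ideal_valP x)).

Definition it_bracket (x y : ideal_type p) : ideal_type p := ad_ideal (ideal_val x) y.

Fact it_bracket_linl (c : K) x y z :
  it_bracket (c *: x + y) z = c *: it_bracket x z + it_bracket y z.
Proof. by apply: ideal_val_inj; apply: bracket_linl. Qed.
Fact it_bracket_linr (c : K) x y z :
  it_bracket z (c *: x + y) = c *: it_bracket z x + it_bracket z y.
Proof. by apply: ideal_val_inj; apply: bracket_linr. Qed.
Fact it_bracket_homog b c x y :
  homog b x -> homog c y -> homog (b (+) c) (it_bracket x y).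
Proof. exact: bracket_homog. Qed.
Fact it_bracket_skew b c x y : homog b x -> homog c y ->
  it_bracket x y = - ((-1) ^+ (b && c) *: it_bracket y x).
Proof. by move=> hx hy; apply: ideal_val_inj; apply: bracket_skew. Qed.
Fact it_bracket_jacobi b c x y z : homog b x -> homog c y ->
  it_bracket x (it_bracket y z) =
    it_bracket (it_bracket x y) z + (-1) ^+ (b && c) *: it_bracket y (it_bracket x z).
Proof. by move=> hx hy; apply: ideal_val_inj; apply: bracket_jacobi. Qed.

HB.instance Definition _ := Superspace_isLieSuperalgebra.Build K (ideal_type p)
  it_bracket_linl it_bracket_linr it_bracket_homog it_bracket_skew
  it_bracket_jacobi.

Definition ideal_incl : lieHom (ideal_type p) g :=
  @LieHom K (ideal_type p) g (@ideal_val K g p)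
    (fun c x y => erefl) (fun b x hx => hx) (fun x y => erefl).
End IdealType.

(* K as a purely even superspace.                                            *)
Definition even_line (K : numFieldType) : Type := K.

Section EvenLine.
Variable K : numFieldType.
Local Notation L := (even_line K).

HB.instance Definition _ := GRing.Lmodule.copy L K^o.

Definition el_homog (b : bool) : set L := [set z | b -> z = 0].

Fact el_homog0 b : el_homog b 0. Proof. by []. Qed.
Fact el_homogP b (c : K) (u v : L) : el_homog b u -> el_homog b v -> el_homog b (c *: u + v).
Proof. by move=> hu hv hb; rewrite hu // hv // scaler0 addr0. Qed.
Fact el_homog_dec (v : L) :
  exists v0 v1, [/\ el_homog false v0, el_homog true v1 & v = v0 + v1].
Proof. by exists v, 0; split=> //; rewrite addr0. Qed.
Fact el_homog_cap (v : L) : el_homog false v -> el_homog true v -> v = 0.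
Proof. by move=> _; apply. Qed.
HB.instance Definition _ := Lmodule_isSuperspace.Build K L
  el_homog0 el_homogP el_homog_dec el_homog_cap.
End EvenLine.

(* K as a purely even abelian Lie superalgebra.                              *)
Definition abelian_line (K : numFieldType) : Type := even_line K.

Section AbelianLine.
Variable K : numFieldType.
Local Notation L := (abelian_line K).

HB.instance Definition _ := Superspace.on L.

Definition al_bracket (x y : L) : L := 0.

Fact al_bracket_linl (c : K) x y z :
  al_bracket (c *: x + y) z = c *: al_bracket x z + al_bracket y z.
Proof. by rewrite /al_bracket scaler0 addr0. Qed.
Fact al_bracket_linr (c : K) x y z :
  al_bracket z (c *: x + y) = c *: al_bracket z x + al_bracket z y.
Proof. by rewrite /al_bracket scaler0 addr0. Qed.
Fact al_bracket_homog b c (x y : L) :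
  homog b x -> homog c y -> homog (b (+) c) (al_bracket x y).
Proof. by move=> _ _; apply: homog0. Qed.
Fact al_bracket_skew b c (x y : L) : homog b x -> homog c y ->
  al_bracket x y = - ((-1) ^+ (b && c) *: al_bracket y x).
Proof. by rewrite /al_bracket scaler0 oppr0. Qed.
Fact al_bracket_jacobi b c (x y z : L) : homog b x -> homog c y ->
  al_bracket x (al_bracket y z) =
    al_bracket (al_bracket x y) z + (-1) ^+ (b && c) *: al_bracket y (al_bracket x z).
Proof. by rewrite /al_bracket scaler0 addr0. Qed.
HB.instance Definition _ := Superspace_isLieSuperalgebra.Build K L
  al_bracket_linl al_bracket_linr al_bracket_homog al_bracket_skew
  al_bracket_jacobi.
End AbelianLine.

(* The one-dimensional supermodule K w_phi, with w_phi := 1 even, on which    *)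
(* x acts by phi x.                                                          *)
Definition char_mod (K : numFieldType) (h : lieSuperalgType K)
  (phi : lieHom h (abelian_line K)) : Type := even_line K.

Section CharMod.
Variables (K : numFieldType) (h : lieSuperalgType K).
Variable phi : lieHom h (abelian_line K).
Local Notation M := (char_mod phi).

HB.instance Definition _ := Superspace.on M.

Definition cm_act (x : h) (v : M) : M := (phi x : K) *: v.

Fact cm_act_linl (c : K) x y v : cm_act (c *: x + y) v = c *: cm_act x v + cm_act y v.
Proof. by rewrite /cm_act lieHom_lin scalerA -scalerDl. Qed.
Fact cm_act_linr (c : K) x u v : cm_act x (c *: u + v) = c *: cm_act x u + cm_act x v.
Proof. by rewrite /cm_act scalerDr !scalerA mulrC. Qed.
Fact cm_act_homog b c x v : homog b x -> homog c v -> homog (b (+) c) (cm_act x v).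
Proof.
move=> /(lieHom_homog phi); case: b c => [] [] hx hv //= _.
  by rewrite /cm_act hx // scale0r.
by rewrite /cm_act (hv isT) scaler0.
Qed.
Fact cm_act_bracket b c x y v : homog b x -> homog c y ->
  cm_act (bracket x y) v =
    cm_act x (cm_act y v) - (-1) ^+ (b && c) *: cm_act y (cm_act x v).
Proof.
move=> /(lieHom_homog phi) hx /(lieHom_homog phi) hy.
have -> : cm_act (bracket x y) v = 0 by rewrite /cm_act lieHom_bracket scale0r.
rewrite /cm_act !scalerA [phi y * phi x]mulrC.
case: b c hx hy => [] [] hx hy; rewrite /= ?expr0 ?mul1r ?subrr //.
by rewrite hx // mul0r mulr0 scale0r subr0.
Qed.
HB.instance Definition _ := Superspace_isLieSupermodule.Build K h M
  cm_act_linl cm_act_linr cm_act_homog cm_act_bracket.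
End CharMod.

Section Whittaker.
Variables (K : numFieldType) (g : lieSuperalgType K) (p : lieIdeal g).
Variable phi : lieHom (ideal_type p) (abelian_line K).

Definition whittaker_annihilator : set g :=
  [set y | forall x : ideal_type p, phi (ad_ideal y x) = 0].

Definition whittaker_vectors (V : lieSupermodType g) : set V :=
  [set v | forall x : ideal_type p, act (ideal_val x) v = (phi x : K) *: v].

Definition quasi_whittaker (V : lieSupermodType g) : Prop :=
  exists b (v : V), [/\ homog b v, whittaker_vectors v & usubmod v = setT].

Definition Wphi : lieSupermodType g := Ind (ideal_incl p) (char_mod phi).

Definition wphi : Wphi := tens (ideal_incl p) 1 ((1 : K) : char_mod phi).

Lemma wphi_even : homog false wphi.
Proof. exact: (@IH_tens _ _ _ _ _ false false _ _ (UH_one g)). Qed.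

Variables (y0 y1 : g) (hy0 : homog false y0) (hy1 : homog true y1).

Lemma y0_xi_even (xi : K) : homog false (uact (uin y0 - xi *: 1) wphi : Wphi).
Proof.
have h : uea_homog false (uin y0 - xi *: 1).
  by rewrite addrC -scaleNr; apply: UH_lin; [apply: UH_one|apply: UH_gen].
exact: (uact_homog h wphi_even).
Qed.

Definition Ltilde (xi : K) : lieSupermodType g := quot (cyclic (y0_xi_even xi)).

Definition y1_wbar (xi : K) : Ltilde xi := qpi _ (act y1 wphi).

Lemma y1_wbar_odd (xi : K) : homog true (y1_wbar xi).
Proof. by exists (act y1 wphi) => //; apply: (act_homog hy1 wphi_even). Qed.

Definition Lxi (lambda : K) (p0 : ideal_type p) (xi : K) : lieSupermodType g :=
  if lambda * xi + phi p0 != 0 then Ltilde xi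
  else (quot (cyclic (y1_wbar_odd xi)) : lieSupermodType g).
End Whittaker.

Definition internal_dsum (K : numFieldType) (V : lmodType K) (A B C : set V) : Prop :=
  A = [set b + c | b in B & c in C] /\ B `&` C = [set 0].

Definition line (K : numFieldType) (V : lmodType K) (y : V) : set V :=
  range (fun c : K => c *: y).

(* Main.v *)
Require Import Defs.
From mathcomp Require Import all_boot all_order all_algebra.
From mathcomp Require Import boolp classical_sets reals complex.
Set Implicit Arguments.
Unset Strict Implicit.
Unset Printing Implicit Defensive.
Import GRing.Theory Num.Theory.
Local Open Scope ring_scope.
Local Open Scope classical_set_scope.
Local Open Scope complex_scope.

(* Let M be a g^phi-stable subspace of Whittaker vectors generating V. The
   operators D_q = q - phi(q), for q in p, lower the degree of words in g applied
   to M. Since (x, q) |-> phi([x, q]) has left kernel g^phi, every finite set of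
   letters admits dual families c_j in g and q_j in p, and the Euler operator
   sum_j c_j D_(q_j) (up to signs) is multiplication by the degree k modulo lower
   degree. Hence V_phi = M, and every nonzero submodule meets M; no PBW theorem is
   needed. Applied to M = C[y0] y0 u + C[y0] y1 y0 u in an irreducible V, this
   expresses u through y0 u, so that y0 is algebraic on u and has an eigenvector
   v in V_phi, of eigenvalue xi say. Then mu (lambda xi + phi(p0)) = 0, and y1 v = 0
   when lambda xi + phi(p0) = 0, so y0 acts on V_phi = span(v, y1 v) by xi, which
   gives uniqueness. The map L_xi -> V sending w to v is injective because its
   kernel avoids span(w, y1 w). *)

(** * The pairing phi([x, q]) and its finite dual systems *)

Section WhittakerPairing.
Variables (K : numFieldType) (g : lieSuperalgType K) (p : lieIdeal g).
Variable phi : lieHom (ideal_type p) (abelian_line K).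
Implicit Types (x y : g) (q : ideal_type p).

Definition chi q : K := phi q.

Lemma chi_lin (c : K) q q' : chi (c *: q + q') = c * chi q + chi q'.
Proof. exact: (lieHom_lin phi c q q'). Qed.

Lemma chi_odd q : homog true q -> chi q = 0.
Proof. by move=> /(lieHom_homog phi); apply. Qed.

Definition pairing q x : K := chi (ad_ideal x q).

Lemma pairing_linl x (c : K) q q' :
  pairing (c *: q + q') x = c * pairing q x + pairing q' x.
Proof.
rewrite /pairing -chi_lin; congr chi; apply: ideal_val_inj.
exact: bracket_linr.
Qed.

Lemma pairing_linr q (c : K) x y :
  pairing q (c *: x + y) = c * pairing q x + pairing q y.
Proof.
rewrite /pairing -chi_lin; congr chi; apply: ideal_val_inj.
exact: bracket_linl.
Qed.

(** [[x, q]] is odd when the parities differ, and [phi] vanishes on odd elements. *)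
Lemma pairing_homog b c q x :
  homog b q -> homog c x -> b != c -> pairing q x = 0.
Proof.
move=> hq hx hbc; apply: chi_odd.
by have := bracket_homog hx hq; case: b c hbc {hx hq} => [] [].
Qed.

Lemma pairing0r q : pairing q 0 = 0.
Proof. by have [_ _ ->] := @lin_D K g K^o (pairing q) (pairing_linr q). Qed.

Lemma pairingZr q (c : K) x : pairing q (c *: x) = c * pairing q x.
Proof. by have [_ -> _] := @lin_D K g K^o (pairing q) (pairing_linr q). Qed.

Lemma pairingZl (c : K) q x : pairing (c *: q) x = c * pairing q x.
Proof. by have [_ -> _] := @lin_D K _ K^o (pairing^~ x) (pairing_linl x). Qed.

Lemma pairing_sum q (I : Type) (r : seq I) (a : I -> K) (F : I -> g) :
  pairing q (\sum_(i <- r) a i *: F i) = \sum_(i <- r) a i * pairing q (F i).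
Proof.
have [_ _ h0] := @lin_D K g K^o (pairing q) (pairing_linr q).
by elim: r => [|i r IH]; rewrite ?big_nil // !big_cons pairing_linr IH.
Qed.

Lemma pairing_suml x (I : Type) (r : seq I) (a : I -> K)
    (F : I -> ideal_type p) :
  pairing (\sum_(i <- r) a i *: F i) x = \sum_(i <- r) a i * pairing (F i) x.
Proof.
have [_ _ h0] := @lin_D K _ K^o (pairing^~ x) (pairing_linl x).
by elim: r => [|i r IH]; rewrite ?big_nil // !big_cons pairing_linl IH.
Qed.

Lemma pairingB q x y : pairing q (x - y) = pairing q x - pairing q y.
Proof. by rewrite -scaleN1r addrC pairing_linr mulN1r addrC. Qed.

Lemma annihilatorN x :
  ~ whittaker_annihilator phi x -> exists q, pairing q x <> 0.
Proof. by move=> /existsNP [q hq]; exists q. Qed.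

(* An entry (b, c, q) stands for c in g and q in p, both of parity b. *)
Definition system := seq (bool * g * ideal_type p).
Implicit Type s : system.

Definition sys_homog s :=
  {in s, forall t, homog t.1.1 t.1.2 /\ homog t.1.1 t.2}.

(** Once [sys_dual s] holds, this is an idempotent map into the span of the [c]'s, with kernel the
    common kernel of the [q]'s. *)
Definition sys_proj s x := \sum_(t <- s) pairing t.2 x *: t.1.2.

Definition sys_dual s :=
  {in s, forall t x, pairing t.2 (x - sys_proj s x) = 0}.

Lemma sys_proj_homog s b x :
  sys_homog s -> homog b x -> homog b (sys_proj s x).
Proof.
move=> hs hx; rewrite /sys_proj big_seq.
elim/big_rec: _ => [|t y ts hy]; first exact: homog0.
have [h1 h2] := hs t ts.
have [e|hb] := eqVneq t.1.1 b; last first.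
  by rewrite (pairing_homog h2 hx) // scale0r add0r.
by apply: homogP => //; rewrite -e.
Qed.

Lemma sys_proj_dual s x : sys_dual s -> sys_proj s (x - sys_proj s x) = 0.
Proof. by move=> hs; rewrite /sys_proj big_seq big1 // => t ts; rewrite hs // scale0r. Qed.

Definition sys_covers s x := whittaker_annihilator phi (x - sys_proj s x).

(* One Gram-Schmidt step for the pairing. *)
Lemma sys_extend s b x : sys_homog s -> sys_dual s -> homog b x ->
  exists s', [/\ sys_homog s', sys_dual s', sys_covers s' x
               & forall y, sys_covers s y -> sys_covers s' y].
Proof.
move=> hs ds hx; have [hc|hc] := pselect (sys_covers s x); first by exists s.
set x' := x - sys_proj s x in hc.
have hx' : homog b x' by apply: homogD => //; apply/homogN/sys_proj_homog.
have [q [hq qx]] : exists q, homog b q /\ pairing q x' = 1.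
  have [q hq] := annihilatorN hc.
  have [q0 [q1 [h0 h1 eq]]] := homog_dec q.
  (* By parity only the component of [q] of parity [b] pairs with [x'], so it can replace [q] and be
     rescaled. *)
  have : pairing (if b then q1 else q0) x' != 0.
    apply/eqP => h; apply: hq; rewrite eq -[q0]scale1r pairing_linl mul1r.
    by case: b hx' h {hx} => hx' h; rewrite h ?addr0 ?add0r;
      [apply: (pairing_homog h0 hx')|apply: (pairing_homog h1 hx')].
  set r := if b then _ else _ => hr; exists ((pairing r x')^-1 *: r); split.
    by apply: homogZ; rewrite /r; case: (b).
  by rewrite pairingZl mulVf.
(* Correcting [q] by its values on the [c]'s makes [q'] see only the residue [y - sys_proj s y],
   while its value on [x] is still 1. *)
pose q' := q - \sum_(t <- s) pairing q t.1.2 *: t.2.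
have q'E y : pairing q' y = pairing q (y - sys_proj s y).
  rewrite /q' -scaleN1r addrC pairing_linl pairing_suml pairingB mulN1r addrC.
  by rewrite pairing_sum; congr (_ - _); apply: eq_bigr => t _; rewrite mulrC.
have q'x : pairing q' x = 1 by rewrite q'E.
have hq' : homog b q'.
  apply: homogD => //; apply: homogN; rewrite big_seq.
  elim/big_rec: _ => [|t y ts hy]; first exact: homog0.
  have [h1 h2] := hs t ts.
  have [e|hb] := eqVneq b t.1.1; last by rewrite (pairing_homog hq h1) // scale0r add0r.
  by apply: homogP => //; rewrite e.
pose s' := (b, x', q') :: s.
have s'E y : y - sys_proj s' y = (y - sys_proj s y) - pairing q' y *: x'.
  by rewrite /sys_proj big_cons /= opprD addrA addrAC.
exists s'; split.
- by move=> t; rewrite inE => /predU1P[->|/hs].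
- move=> t ts y; rewrite s'E.
  have x'E : x' - sys_proj s x' = x' by rewrite sys_proj_dual // subr0.
  move: ts; rewrite inE => /predU1P[->|ts] /=.
    rewrite pairingB pairingZr !q'E sys_proj_dual // subr0 x'E qx mulr1.
    exact: subrr.
  by rewrite pairingB pairingZr !ds // mulr0 subr0.
- by move=> r; rewrite s'E q'x scale1r subrr; exact: pairing0r.
- move=> y hy r; rewrite s'E q'E [pairing q _]hy scale0r subr0; exact: hy.
Qed.

(** Iterates [sys_extend] along the list; a letter that is not homogeneous imposes no condition and
    is skipped. *)
Lemma sys_exists (L : seq g) : exists s, sys_homog s /\
  {in L, forall x b, homog b x -> sys_covers s x}.
Proof.
suff [s [h1 _ h2]] : exists s, [/\ sys_homog s, sys_dual s &
    {in L, forall x b, homog b x -> sys_covers s x}] by exists s.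
elim: L => [|x L [s [hs ds cs]]]; first by exists [::].
have [[b hx]|hx] := pselect (exists b, homog b x); last first.
  exists s; split=> // y; rewrite inE => /predU1P[->|/cs //] b hb.
  by case: hx; exists b.
have [s' [hs' ds' cx cs']] := sys_extend hs ds hx.
exists s'; split=> // y; rewrite inE => /predU1P[->|yL] c hy //.
exact/cs'/(cs y yL c).
Qed.

End WhittakerPairing.

(** * The operators D_q = q - phi(q) and their commutation with g *)

Section WhittakerShift.
Variables (K : numFieldType) (g : lieSuperalgType K) (p : lieIdeal g).
Variable phi : lieHom (ideal_type p) (abelian_line K).
Variable V : lieSupermodType g.
Implicit Types (x z : g) (q : ideal_type p) (u v : V).

Lemma actN x v : act x (- v) = - act x v.
Proof. by rewrite -scaleN1r actZr scaleN1r. Qed.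

Lemma act_sum x (I : Type) (r : seq I) (F : I -> V) :
  act x (\sum_(i <- r) F i) = \sum_(i <- r) act x (F i).
Proof. by elim: r => [|i r IH]; rewrite ?big_nil ?actr0 // !big_cons actDr IH. Qed.

Lemma act_suml (I : Type) (r : seq I) (F : I -> g) v :
  act (\sum_(i <- r) F i) v = \sum_(i <- r) act (F i) v.
Proof.
have [_ _ h0] := lin_D (fun (c : K) (x y : g) => act_linl c x y v).
by elim: r => [|i r IH]; rewrite ?big_nil // !big_cons actDl IH.
Qed.

Definition wshift q v : V := act (ideal_val q) v - chi phi q *: v.

Lemma wshift_lin q (c : K) u v :
  wshift q (c *: u + v) = c *: wshift q u + wshift q v.
Proof.
by rewrite /wshift act_linr scalerBr !scalerDr !scalerA opprD [chi _ _ * c]mulrC addrACA.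
Qed.

Lemma wshift_linl (c : K) q q' v :
  wshift (c *: q + q') v = c *: wshift q v + wshift q' v.
Proof.
rewrite /wshift chi_lin (act_linl c (ideal_val q)) scalerDl scalerBr scalerA opprD.
by rewrite addrACA.
Qed.

Lemma wshift0 q : wshift q 0 = 0.
Proof. by rewrite /wshift actr0 scaler0 subr0. Qed.

Lemma signrr_scale (b : bool) (v : V) :
  (-1) ^+ b *: ((-1) ^+ b *: v) = v.
Proof. by rewrite scalerA -signr_addb addbb scale1r. Qed.

(** [[x, q]] acts as the supercommutator of [x] and [q]; as it lies in the ideal, it also acts as
    D_[x, q] plus the scalar [pairing phi q x]. *)
Lemma wshift_act b c x q v : homog b x -> homog c q ->
  wshift q (act x v) = (-1) ^+ (b && c) *:
    (act x (wshift q v) - wshift (ad_ideal x q) v - pairing phi q x *: v).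
Proof.
move=> hx hq; rewrite /wshift -/(pairing phi q x).
have -> : act (ideal_val (ad_ideal x q)) v = act (bracket x (ideal_val q)) v by [].
rewrite (act_bracket v hx hq) actDr actN actZr.
have E (A B C D : V) : A - C - (A - B - D) - D = B - C.
  by rewrite opprB addrAC subrKA opprB addrC subrKA.
rewrite E scalerBr signrr_scale; congr (_ - _); rewrite scalerA; congr (_ *: _).
by case: c hq => [/chi_odd ->|]; rewrite ?mulr0 // andbF mul1r.
Qed.

Lemma whittaker_homogP v :
  (forall b q, homog b q -> wshift q v = 0) -> whittaker_vectors phi v.
Proof.
move=> h q; apply/eqP; rewrite -subr_eq0 -/(wshift q v).
have [q0 [q1 [h0 h1 ->]]] := homog_dec q.
by rewrite -[q0]scale1r wshift_linl (h _ _ h0) (h _ _ h1) scaler0 addr0.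
Qed.

Lemma whittaker_wshift q v : whittaker_vectors phi v -> wshift q v = 0.
Proof. by move=> hv; rewrite /wshift hv subrr. Qed.

Lemma whittaker_lin (c : K) u v : whittaker_vectors phi u ->
  whittaker_vectors phi v -> whittaker_vectors phi (c *: u + v).
Proof.
move=> hu hv; apply: whittaker_homogP => b q _.
by rewrite wshift_lin !whittaker_wshift // scaler0 addr0.
Qed.

Lemma whittaker0 : whittaker_vectors phi (0 : V).
Proof. by move=> q; rewrite actr0 scaler0. Qed.

(** In [wshift_act] both shifts vanish on [v], the second because [p] is an ideal, and the scalar
    vanishes by definition of g^phi. *)
Lemma whittaker_act b z v : homog b z -> whittaker_annihilator phi z ->
  whittaker_vectors phi v -> whittaker_vectors phi (act z v).
Proof.
move=> hz az hv; apply: whittaker_homogP => c q hq.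
rewrite (wshift_act _ hz hq) !whittaker_wshift // actr0 [pairing _ _ _]az.
by rewrite scale0r !subr0 scaler0.
Qed.

(** * The word-length filtration and the Euler operator *)

Section Filtration.
Variable M : set V.

(* Level k.+1 consists of the combinations of words of length at most k in
   letters from S applied to M, and level 0 is zero. *)
Inductive filt (S : set g) : nat -> V -> Prop :=
| filt0 k : filt S k 0
| filtM k m : M m -> filt S k.+1 m
| filt_lin k (c : K) u v : filt S k u -> filt S k v -> filt S k (c *: u + v)
| filt_act k b x v : S x -> homog b x -> filt S k.+1 v -> filt S k.+2 (act x v).

Lemma filt_sub (S T : set g) k v : S `<=` T -> filt S k v -> filt T k v.
Proof.
move=> ST; elim=> {k v} [k|k m|k c u v _ hu _ hv|k b x v xS hx _ hv].
- exact: filt0.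
- exact: filtM.
- exact: filt_lin.
- by apply: filt_act hx hv; apply: ST.
Qed.

(** A combination of words involves finitely many letters, which a finite dual system can cover. *)
Lemma filt_finite k v : filt setT k v ->
  exists L : seq g, filt [set x | x \in L] k v.
Proof.
elim=> {k v} [k|k m hm|k c u v _ [L1 h1] _ [L2 h2]|k b x v _ hx _ [L h]].
- by exists [::]; apply: filt0.
- by exists [::]; apply: filtM.
- exists (L1 ++ L2); apply: filt_lin; [apply: filt_sub h1|apply: filt_sub h2];
    by move=> x /= xL; rewrite mem_cat xL ?orbT.
- exists (x :: L); apply: filt_act hx _; first by rewrite /= inE eqxx.
  by apply: filt_sub h => y /= yL; rewrite inE yL orbT.
Qed.

Local Notation F := (filt setT).

Lemma filt0_eq0 S k v : filt S k v -> k = 0%N -> v = 0.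
Proof.
elim=> {k v} // k c u v _ hu _ hv k0.
by rewrite hu // hv // scaler0 addr0.
Qed.

Lemma filtS S k v : filt S k v -> filt S k.+1 v.
Proof.
elim=> {k v} [k|k m|k c u v _ hu _ hv|k b x v xS hx _ hv].
- exact: filt0.
- exact: filtM.
- exact: filt_lin.
- exact: filt_act hx hv.
Qed.

Lemma filt_leq S k l v : (k <= l)%N -> filt S k v -> filt S l v.
Proof.
move=> /subnK <-; elim: (l - k)%N => [//|n IH] h; rewrite addSn.
exact/filtS/IH.
Qed.

Lemma filtD S k u v : filt S k u -> filt S k v -> filt S k (u + v).
Proof. by move=> hu hv; rewrite -[u]scale1r; apply: filt_lin. Qed.
Lemma filtZ S k (c : K) u : filt S k u -> filt S k (c *: u).
Proof. by move=> hu; rewrite -[_ *: _]addr0; apply: filt_lin => //; apply: filt0. Qed.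
Lemma filtN S k u : filt S k u -> filt S k (- u).
Proof. by rewrite -scaleN1r; apply: filtZ. Qed.
Lemma filtB S k u v : filt S k u -> filt S k v -> filt S k (u - v).
Proof. by move=> hu hv; apply: filtD => //; apply: filtN. Qed.
Lemma filt_sum S k (I : eqType) (r : seq I) (G : I -> V) :
  {in r, forall i, filt S k (G i)} -> filt S k (\sum_(i <- r) G i).
Proof.
move=> h; rewrite big_seq; elim/big_rec: _ => [|i v ir hv]; first exact: filt0.
by apply: filtD => //; apply: h.
Qed.

Lemma filt_actT k x v : F k v -> F k.+1 (act x v).
Proof.
case: k => [/filt0_eq0 -> //|k hv]; first by rewrite actr0; apply: filt0.
have [x0 [x1 [h0 h1 ->]]] := homog_dec x.
by rewrite actDl; apply: filtD; [apply: filt_act h0 _|apply: filt_act h1 _].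
Qed.

Lemma filt_uact a v : (exists k, F k v) -> exists k, F k (uact a v).
Proof.
elim/uea_ind: a v => [x| | |a b ha hb|c a ha|a b ha hb] v.
- by move=> [k hk]; exists k.+1; rewrite uact_gen; apply: filt_actT.
- by exists 0%N; rewrite uact0; apply: filt0.
- by rewrite uact1.
- move=> h; have [k hk] := ha v h; have [l hl] := hb v h.
  exists (maxn k l); rewrite uactDl; apply: filtD.
    by apply: filt_leq hk; apply: leq_maxl.
  by apply: filt_leq hl; apply: leq_maxr.
- by move=> /ha [k hk]; exists k; rewrite uactZl; apply: filtZ.
- by move=> h; rewrite uactM; apply/ha/hb.
Qed.

Hypothesis M0 : M 0.
Hypothesis M_lin : forall (c : K) u v, M u -> M v -> M (c *: u + v).
Hypothesis M_whittaker : M `<=` whittaker_vectors phi (V := V).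
Hypothesis M_annihilator : forall b z m,
  homog b z -> whittaker_annihilator phi z -> M m -> M (act z m).

Lemma filt1_M k v : F k v -> (k <= 1)%N -> M v.
Proof.
elim=> {k v} // k c u v _ hu _ hv k1.
by apply: M_lin; [apply: hu|apply: hv].
Qed.

(** Moving [z] to the right past a letter [x] costs [[z, x]], a single letter in place of [x]; at
    the end [z] meets [M], which it preserves. *)
Lemma filt_annihilator k b z v :
  homog b z -> whittaker_annihilator phi z -> F k v -> F k (act z v).
Proof.
move=> hz az; elim=> {k v} [k|k m|k c u v _ hu _ hv|k c x v _ hx hv hzv].
- by rewrite actr0; apply: filt0.
- by move=> hm; apply/filtM/(M_annihilator hz az).
- by rewrite act_linr; apply: filt_lin.
- have -> : act z (act x v) =
      act (bracket z x) v + (-1) ^+ (b && c) *: act x (act z v).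
    by rewrite (act_bracket v hz hx) subrK.
  by apply: filtD; [|apply: filtZ]; apply: filt_actT.
Qed.

(** Induction on words through [wshift_act]: passing a letter leaves D_[x, q] on a shorter word, or
    erases the letter. The induction ranges over all [q], since [[x, q]] replaces [q]. *)
Lemma filt_wshift k b q v : homog b q -> F k.+1 v -> F k (wshift q v).
Proof.
move: {-1}k.+1 (erefl k.+1) => l el hq h.
elim: h b q k hq el => {l v} [l|l m hm|l c u v _ hu _ hv|l c x v _ hx h hv] b q k hq el.
- by rewrite wshift0; apply: filt0.
- by rewrite (whittaker_wshift _ (M_whittaker hm)); apply: filt0.
- by rewrite wshift_lin; apply: filt_lin; [apply: hu hq el|apply: hv hq el].
case: el => ->; rewrite (wshift_act _ hx hq).
apply/filtZ/filtB; last exact: filtZ.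
apply: filtB; first by apply: filt_actT; apply: hv hq _.
have hxq : homog (c (+) b) (ad_ideal x q) := bracket_homog hx hq.
by apply: filtS; apply: hv hxq _.
Qed.

(** The sign compensates the one in [wshift_act]: moving D_q past [x] of the same parity [b]
    produces [- (-1) ^+ b] times the pairing. *)
Definition euler (s : system p) v : V :=
  \sum_(t <- s) - ((-1) ^+ t.1.1 *: act t.1.2 (wshift t.2 v)).

Lemma euler_lin s (c : K) u v :
  euler s (c *: u + v) = c *: euler s u + euler s v.
Proof.
rewrite /euler scaler_sumr -big_split /=; apply: eq_bigr => t _.
by rewrite wshift_lin act_linr scalerDr opprD scalerN !scalerA [c * _]mulrC.
Qed.

(* The dual system makes euler the degree operator on the associated graded. *)
Lemma filt_euler s (S : set g) k v : sys_homog s ->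
  (forall x, S x -> forall b, homog b x -> sys_covers phi s x) ->
  filt S k.+1 v -> F k (euler s v - k%:R *: v).
Proof.
move=> hs cs; move: {-1}k.+1 (erefl k.+1) => l el h.
elim: h k el => {l v} [l|l m hm|l c u v _ hu _ hv|l b x v xS hx h hv] k el.
- rewrite scaler0 subr0 /euler big1 => [|t _]; first exact: filt0.
  by rewrite wshift0 actr0 scaler0 oppr0.
- rewrite /euler big1 => [|t _].
    rewrite sub0r; apply: filtN; case: k {el} => [|k]; last exact/filtZ/filtM.
    by rewrite scale0r; apply: filt0.
  by rewrite (whittaker_wshift _ (M_whittaker hm)) actr0 scaler0 oppr0.
- have -> : euler s (c *: u + v) - k%:R *: (c *: u + v) =
     c *: (euler s u - k%:R *: u) + (euler s v - k%:R *: v).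
    by rewrite euler_lin scalerDr scalerBr opprD addrACA !scalerA [c * _]mulrC.
  by apply: filt_lin; [apply: hu|apply: hv].
case: el => -> {k}.
pose term (t : bool * g * ideal_type p) v := - ((-1) ^+ t.1.1 *: act t.1.2 (wshift t.2 v)) : V.
have hvT : F l.+1 v by apply: filt_sub h.
(* A Leibniz rule modulo level [l.+1]: each error term is a letter applied to a shift of [v], and a
   shift lowers the level by one. *)
have hterm : {in s, forall t, F l.+1 (term t (act x v) -
    (act x (term t v) + pairing phi t.2 x *: act t.1.2 v))}.
  move=> [[d c] q] ts; have [hc hq] := hs _ ts; rewrite /term /= in hc hq *.
  set e := (-1) ^+ (b && d) : K.
  have ecx : act c (act x (wshift q v)) =
      act (bracket c x) (wshift q v) + e *: act x (act c (wshift q v)).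
    by rewrite (act_bracket _ hc hx) andbC subrK.
  have -> : - ((-1) ^+ d *: act c (wshift q (act x v))) -
      (act x (- ((-1) ^+ d *: act c (wshift q v))) + pairing phi q x *: act c v) =
      ((-1) ^+ d * e) *: (act c (wshift (ad_ideal x q) v) -
        act (bracket c x) (wshift q v)).
    rewrite (wshift_act _ hx hq) -/e.
    move: (wshift q v) (wshift (ad_ideal x q) v) ecx => Dv Dv' ecx.
    rewrite actZr !actDr !actN !actZr ecx.
    rewrite scalerA opprD opprK !scalerBr scalerDr !scalerA.
    rewrite -[_ * e * e]mulrA -[e * e]signr_addb addbb mulr1 !opprB.
    (* The pairing vanishes unless [b = d], and then the two signs cancel. *)
    have -> : (-1) ^+ d * e * pairing phi q x = pairing phi q x.
      have [edb|hdb] := eqVneq b d; first by rewrite /e edb andbb -signr_addb addbb mul1r.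
      by rewrite (pairing_homog _ hq hx) ?mulr0 // eq_sym.
    by rewrite addrC subrKA opprD addrC addrA subrK.
  apply/filtZ/filtB; last by apply/filt_actT/(filt_wshift hq).
  apply/filt_actT/filt_wshift; last exact: hvT.
  exact: bracket_homog hx hq.
(* Summing the Leibniz rule yields [sys_proj phi s x] applied to [v]. This is [act x v] up to an
   element of g^phi, which raises no level, and the extra copy turns [l] into [l.+1]. *)
have -> : euler s (act x v) - l.+1%:R *: act x v =
    \sum_(t <- s) (term t (act x v) -
      (act x (term t v) + pairing phi t.2 x *: act t.1.2 v)) +
    act x (euler s v - l%:R *: v) - act (x - sys_proj phi s x) v.
  rewrite sumrB big_split /= actDr actDl !actN actZr -act_sum.
  have -> : act (- sys_proj phi s x) v =
      - \sum_(t <- s) pairing phi t.2 x *: act t.1.2 v.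
    rewrite -scaleN1r actZl scaleN1r act_suml.
    by congr (- _); apply: eq_bigr => t _; rewrite actZl.
  rewrite -/(euler s v) -/(euler s (act x v)) -natr1 scalerDl scale1r.
  move: (euler s _) (act x (euler s v)) (\sum_(t <- s) _) => X Y P.
  by rewrite opprB -addrA (addrACA Y) subrKA -opprD.
apply: filtB.
  by apply: filtD; [apply: filt_sum|apply/filt_actT/hv].
have hpx := homogD hx (homogN (sys_proj_homog phi hs hx)).
exact: filt_annihilator hpx (cs _ xS _ hx) hvT.
Qed.

(** [euler] kills Whittaker vectors, so [filt_euler] puts a nonzero integer multiple of [v] one
    level lower; repeated division leads down to level 1, which is [M]. *)
Lemma filt_whittaker k v : F k v -> whittaker_vectors phi v -> M v.
Proof.
elim: k => [|k IH] hv wv; first exact: filt1_M hv _.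
case: k => [|k] in IH hv *; first exact: filt1_M hv _.
apply: IH => //; have [L hL] := filt_finite hv.
have [s [hs cs]] := sys_exists phi L.
have := filt_euler hs cs hL; rewrite /euler big1 => [|t _]; last first.
  by rewrite whittaker_wshift // actr0 scaler0 oppr0.
move=> /(filtZ (- k.+1%:R^-1)).
by rewrite sub0r scalerN scaleNr opprK scalerA mulVf ?pnatr_eq0 // scale1r.
Qed.

(** Descent: while [v] is not a Whittaker vector, some D_q [v] is nonzero, in [N] and of lower
    level. A Whittaker vector lies in [M] by [filt_whittaker]. *)
Lemma filt_meets k (N : set V) v :
  (forall (c : K) u w, N u -> N w -> N (c *: u + w)) ->
  (forall x u, N u -> N (act x u)) ->
  F k v -> N v -> v <> 0 -> exists m, [/\ M m, N m & m <> 0].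
Proof.
move=> N_lin N_act; elim: k v => [|k IH] v hv Nv nz.
  by case: nz; apply: filt0_eq0 hv _.
have [wv|] := pselect (whittaker_vectors phi v).
  by exists v; split=> //; apply: filt_whittaker hv wv.
move=> /(contra_not (@whittaker_homogP v)) /existsNP [b /existsNP [q]].
move=> /not_implyP [hq hqv]; apply: (IH (wshift q v)) => //.
  exact: filt_wshift hq hv.
by rewrite /wshift addrC -scaleNr; apply/N_lin/N_act.
Qed.

End Filtration.
End WhittakerShift.

(** * Supermodule homomorphisms of either parity *)

Section Homomorphisms.
Variables (K : numFieldType) (g : lieSuperalgType K).

Lemma homog_decb (V : superspaceType K) b (v : V) :
  exists u w, [/\ homog b u, homog (~~ b) w & v = u + w].
Proof.
have [u [w [hu hw ->]]] := homog_dec v; case: b; last by exists u, w.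
by exists w, u; split=> //; rewrite addrC.
Qed.

Lemma homog_capb (V : superspaceType K) b (v : V) :
  homog b v -> homog (~~ b) v -> v = 0.
Proof. by case: b => h1 h2; apply: homog_cap. Qed.

(** Commutation carries no sign even for odd [d], in agreement with [pshift], which keeps the
    action: an odd map into [W] is an even one into its parity shift. *)
Definition shom (d : bool) (V W : lieSupermodType g) (f : V -> W) : Prop :=
  [/\ forall (c : K) u v, f (c *: u + v) = c *: f u + f v,
      forall (x : g) v, f (act x v) = act x (f v)
    & forall b v, homog b v -> homog (b (+) d) (f v)].

Lemma shom_uact d (V W : lieSupermodType g) (f : V -> W) a v :
  shom d f -> f (uact a v) = uact a (f v).
Proof.
move=> [f_lin f_act _]; have [fD fZ f0] := lin_D f_lin.
elim/uea_ind: a v => [x| | |a b ha hb|c a ha|a b ha hb] v.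
- by rewrite !uact_gen f_act.
- by rewrite !uact0.
- by rewrite !uact1.
- by rewrite !uactDl fD ha hb.
- by rewrite !uactZl fZ ha.
- by rewrite !uactM ha hb.
Qed.

Lemma shom_iso d (V W : lieSupermodType g) (f : V -> W) :
  shom d f -> bijective f -> iso_up_to_parity W V.
Proof.
move=> [f_lin f_act f_homog] [h fK hK].
have h_lin (c : K) u v : h (c *: u + v) = c *: h u + h v.
  by apply: (can_inj fK); rewrite hK f_lin !hK.
have h_act (x : g) v : h (act x v) = act x (h v).
  by apply: (can_inj fK); rewrite hK f_act !hK.
have h_bij : bijective h by exists f.
have [fD _ f0] := lin_D f_lin.
have h_homog b v : homog b v -> homog (b (+) d) (h v).
  move=> hv; have [u [w [hu hw e]]] := homog_decb (b (+) d) (h v).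
  (* The component [w] of the wrong parity has an image of both parities, hence zero; injectivity
     then removes it. *)
  have fw : f w = 0.
    have ku := f_homog _ _ hu; have kw := f_homog _ _ hw.
    rewrite -addbA addbb addbF in ku; rewrite addNb -addbA addbb addbF in kw.
    apply: homog_capb (kw); have := congr1 f e; rewrite hK fD => ev.
    have -> : f w = v - f u by rewrite ev addrC addrA addNr add0r.
    by apply: homogD => //; apply: homogN.
  by rewrite e (can_inj fK (etrans fw (esym f0))) addr0.
by case: d h_homog {f_homog} => h_homog; [right|left]; exists h; split=> // b v /h_homog;
  case: b.
Qed.

Lemma quot_lift d (V W : lieSupermodType g) (N : subsupermod V) (f : V -> W) :
  shom d f -> (forall n, subsm_set N n -> f n = 0) ->
  exists2 f' : quot N -> W, shom d f' & forall v, f' (qpi N v) = f v.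
Proof.
move=> [f_lin f_act f_homog] fN; have [fD fZ f0] := lin_D f_lin.
pose f' (q : quot N) := f (qrep q).
have f'E v : f' (qpi N v) = f v.
  apply/eqP; rewrite -subr_eq0 -scaleN1r -fZ -fD scaleN1r; apply/eqP.
  exact/fN/qrepP.
exists f' => //; split=> [c u v|x v|b v].
- have [r <-] := qpi_surj u; have [s <-] := qpi_surj v.
  by rewrite -qpi_lin !f'E.
- have [r <-] := qpi_surj v.
  have -> : act x (qpi N r) = qpi N (act x r) by apply: quot_actE.
  by rewrite !f'E.
- by move=> [r hr <-]; rewrite f'E; apply: f_homog.
Qed.

Lemma qpi_shom (V : lieSupermodType g) (N : subsupermod V) : shom false (qpi N).
Proof.
split=> [c u v|x v|b v hv]; first exact: qpi_lin.
  by rewrite -quot_actE.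
by rewrite addbF; exists v.
Qed.

Lemma qpi_eq0 (V : lieSupermodType g) (N : subsupermod V) v :
  subsm_set N v -> qpi N v = 0.
Proof. by move=> hv; apply/qpiP; rewrite subr0. Qed.

Lemma quot_generated (V : lieSupermodType g) (N : subsupermod V) v :
  usubmod v = setT -> usubmod (qpi N v) = setT.
Proof.
move=> hv; rewrite -subTset => q _; have [u <-] := qpi_surj q.
have : usubmod v u by rewrite hv.
by move=> [a _ <-]; exists a => //; rewrite (shom_uact _ _ (qpi_shom N)).
Qed.

Lemma irreducible_generated (V : lieSupermodType g) b (v : V) :
  irreducible_supermod V -> homog b v -> v <> 0 -> usubmod v = setT.
Proof.
move=> [_ irr] hv nz; case: (irr (cyclic hv)) => //= e.
have : usubmod v v by exists 1 => //; rewrite uact1.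
by rewrite e.
Qed.

End Homomorphisms.

(** * The universal property of W(phi) *)

Section Universal.
Variables (K : numFieldType) (g : lieSuperalgType K) (p : lieIdeal g).
Variable phi : lieHom (ideal_type p) (abelian_line K).
Local Notation W := (Wphi phi).

Lemma Wphi_tens u (m : char_mod phi) :
  tens (ideal_incl p) u m = (m : K) *: (uact u (wphi phi) : W).
Proof.
have -> : m = (m : K) *: ((1 : K) : char_mod phi) by rewrite [RHS]mulr1.
rewrite tensZr; congr (_ *: _); first by rewrite [RHS]mulr1.
suff h a (x : W) : uact a x = ind_lmul a x by rewrite h ind_lmul_tens mulr1.
have lmul1 (y : W) : ind_lmul 1 y = y.
  have [aD aZ a0] := lin_D (@ind_lmul_lin _ _ _ (ideal_incl p) (char_mod phi) 1).
  elim/ind_ind: y => [b n| |y z hy hz|c y hy].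
  - by rewrite ind_lmul_tens mul1r.
  - by rewrite a0.
  - by rewrite aD hy hz.
  - by rewrite aZ hy.
elim/uea_ind: a x => [y| | |a b ha hb|c a ha|a b ha hb] x.
- by rewrite uact_gen.
- by rewrite uact0 -[0 in RHS](scale0r 1) ind_lmulZl scale0r.
- by rewrite uact1 lmul1.
- by rewrite uactDl ind_lmulDl ha hb.
- by rewrite uactZl ind_lmulZl ha.
- by rewrite uactM ind_lmulM ha hb.
Qed.

Lemma wphi_generates : usubmod (wphi phi) = setT.
Proof.
rewrite -subTset => x _; elim/ind_ind: x => [u m| |u v hu hv|c u hu].
- by rewrite Wphi_tens; exists ((m : K) *: u) => //; rewrite uactZl.
- exact: cyclic0.
- by rewrite -[u]scale1r; apply: cyclic_lin.
- by rewrite -[_ *: _]addr0; apply: cyclic_lin => //; apply: cyclic0.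
Qed.

Lemma wphi_whittaker : whittaker_vectors phi (wphi phi).
Proof.
move=> q; have -> : act (ideal_val q) (wphi phi) =
    tens (ideal_incl p) (1 * umap (ideal_incl p) (uin q)) ((1 : K) : char_mod phi).
  by rewrite umap_gen mul1r -[uin _]mulr1; apply: ind_lmul_tens.
by rewrite tens_balance uact_gen -tensZr.
Qed.

Section Lift.
Variables (V : lieSupermodType g) (v : V).

Fixpoint lift_term (t : iterm g (char_mod phi)) : V :=
  match t with
  | ITens u m => uact u ((m : K) *: v) | IZero => 0
  | IAdd s t => lift_term s + lift_term t
  | IScale c s => c *: lift_term s
  end.

Hypothesis hv : whittaker_vectors phi v.

(** Sending [m] to [m *: v] is a map of U(p)-modules; this is what the balancing relation asks of
    [lift_term]. *)
Lemma umap_whittaker (a : Uea (ideal_type p)) (m : char_mod phi) :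
  uact (umap (ideal_incl p) a) ((m : K) *: v) = (uact a m : K) *: v.
Proof.
elim/uea_ind: a m => [x| | |a b ha hb|c a ha|a b ha hb] m.
- by rewrite umap_gen !uact_gen actZr [act (ideal_incl p x) v]hv scalerA mulrC.
- by rewrite umap0 !uact0 scale0r.
- by rewrite umap1 !uact1.
- by rewrite umapD !uactDl ha hb -scalerDl.
- by rewrite umapZ !uactZl ha scalerA.
- by rewrite umapM !uactM hb ha.
Qed.

Lemma lift_termP s t : ieq (ideal_incl p) s t -> lift_term s = lift_term t.
Proof.
elim=> //=; do ?by move=> *; congruence.
- by move=> *; rewrite addrA.
- by move=> *; rewrite addrC.
- by move=> *; rewrite add0r.
- by move=> *; rewrite scaleN1r addNr.
- by move=> *; rewrite scalerA.
- by move=> *; rewrite scale1r.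
- by move=> *; rewrite scalerDr.
- by move=> *; rewrite scalerDl.
- by move=> *; rewrite uactDl.
- by move=> u m n; have [<- _ _] := lin_D (@uact_lin _ _ V u); rewrite -scalerDl.
- by move=> *; rewrite uactZl.
- by move=> c u m; have [_ <- _] := lin_D (@uact_lin _ _ V u); rewrite scalerA.
- by move=> u a m; rewrite uactM umap_whittaker.
Qed.

(** Frobenius reciprocity; the map has the parity of [v] because the generator [wphi] is even. *)
Lemma Wphi_lift d : homog d v ->
  exists2 f : W -> V, shom d f & f (wphi phi) = v.
Proof.
move=> hd; pose f (x : W) := lift_term (irep x).
have fE t : f (ipi (ideal_incl p) t) = lift_term t by apply/lift_termP/irepP.
have f_lin (c : K) (x y : W) : f (c *: x + y) = c *: f x + f y.
  have [r <-] := ipi_surj x; have [s <-] := ipi_surj y.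
  by rewrite -ipiZ -ipiD !fE.
have [fD fZ f0] := lin_D f_lin.
have fT u m : f (tens (ideal_incl p) u m) = uact u ((m : K) *: v) by apply: fE.
exists f; last by rewrite fT uact1 scale1r.
split=> // [x y|b x].
  elim/ind_ind: y => [u m| |u w hu hw|c u hu].
  - rewrite fT -[RHS]uact_gen -uactM -fT; congr f; exact: ind_lmul_tens.
  - by rewrite actr0 f0 actr0.
  - by rewrite actDr !fD actDr hu hw.
  - by rewrite actZr !fZ actZr hu.
elim=> {b x} [b c u m hu hm|b|b c x y _ hx _ hy].
- rewrite fT -addbA; apply: uact_homog => //.
  case: c hm => [hm|_]; last exact: homogZ.
  by rewrite (hm isT) scale0r; apply: homog0.
- by rewrite f0; apply: homog0.
- by rewrite f_lin; apply: homogP.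
Qed.
End Lift.
End Universal.

(** * Eigenvectors from an annihilating polynomial *)

Section Eigenvector.
Variables (K : numClosedFieldType) (g : lieSuperalgType K).
Variables (V : lieSupermodType g) (y : g).

Definition polact (P : {poly K}) (v : V) : V := uact (horner_alg (uin y) P) v.

Lemma polactC (c : K) v : polact c%:P v = c *: v.
Proof. by rewrite /polact horner_algC uactZl uact1. Qed.

Lemma polactD P Q v : polact (P + Q) v = polact P v + polact Q v.
Proof. by rewrite /polact rmorphD uactDl. Qed.

Lemma polactM P Q v : polact (P * Q) v = polact P (polact Q v).
Proof. by rewrite /polact rmorphM uactM. Qed.

Lemma polactX v : polact 'X v = act y v.
Proof. by rewrite /polact horner_algX uact_gen. Qed.

Lemma polact_linl (c : K) P Q v :
  polact (c *: P + Q) v = c *: polact P v + polact Q v.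
Proof. by rewrite polactD -mul_polyC polactM polactC. Qed.

Lemma polactXM P v : polact (P * 'X) v = act y (polact P v).
Proof. by rewrite mulrC polactM polactX. Qed.

Lemma polact_ind (A : set V) v :
  A v -> (forall (c : K) u w, A u -> A w -> A (c *: u + w)) ->
  (forall u, A u -> A (act y u)) -> forall P, A (polact P v).
Proof.
move=> Av A_lin A_act; have A0 : A 0.
  by have := A_lin (-1) v v Av Av; rewrite scaleN1r addNr.
elim/poly_ind => [|P c IH].
  by rewrite -polyC0 polactC scale0r.
rewrite polactD addrC polactXM polactC; apply: A_lin => //; exact: A_act.
Qed.

(** Linear factors ['X - xi] are split off [P] until the cofactor [Q] no longer kills [v]; then
    [polact Q v] is killed by [y - xi]. *)
Lemma eigenvector (P : {poly K}) v : P != 0 -> v <> 0 -> polact P v = 0 ->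
  exists Q xi, polact Q v <> 0 /\ act y (polact Q v) = xi *: polact Q v.
Proof.
move=> P0 nz; move: {2}(size P) (leqnn (size P)) => n.
elim: n P P0 => [|n IH] P P0; first by rewrite leqn0 size_poly_eq0 (negbTE P0).
move=> sP Pv; have s1 : size P != 1%N.
  apply/negP => /eqP/eqP/size_poly1P [c c0 eP]; apply: nz.
  by move: Pv; rewrite eP polactC => /eqP; rewrite scaler_eq0 (negbTE c0) => /eqP.
have [xi /factor_theorem [Q eQ]] := closed_rootP P s1.
have Q0 : Q != 0 by apply: contra_neq P0 => Q0; rewrite eQ Q0 mul0r.
have [Qv|Qv] := pselect (polact Q v = 0).
  apply: (IH Q) => //; move: sP.
  by rewrite eQ size_Mmonic ?monicXsubC // size_XsubC addn2.
exists Q, xi; split=> //; move: Pv; rewrite eQ mulrC polactM polactD polactX.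
by rewrite -polyCN polactC scaleNr => /eqP; rewrite subr_eq0 => /eqP.
Qed.
End Eigenvector.

(** * Whittaker vectors under the action of y0 and y1 *)

Section Classification.
Variables (K : numClosedFieldType) (g : lieSuperalgType K) (p : lieIdeal g).
Variable phi : lieHom (ideal_type p) (abelian_line K).
Variables (y0 y1 : g) (hy0 : homog false y0) (hy1 : homog true y1).
Hypothesis gphi_even : internal_dsum (whittaker_annihilator phi `&` homog false)
  (ideal_set p `&` homog false) (line y0).
Hypothesis gphi_odd : internal_dsum (whittaker_annihilator phi `&` homog true)
  (ideal_set p `&` homog true) (line y1).
Variables (lambda mu : K) (p0 p1 : ideal_type p).
Hypothesis hp1 : homog true p1.
Hypothesis y1y1 : bracket y1 y1 = lambda *: y0 + ideal_val p0.
Hypothesis y0y1 : bracket y0 y1 = mu *: y1 + ideal_val p1.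

Lemma dsum_annihilator b (y : g) :
  internal_dsum (whittaker_annihilator phi `&` homog b)
    (ideal_set p `&` homog b) (line y) -> whittaker_annihilator phi y.
Proof.
move=> [e _]; suff [] : (whittaker_annihilator phi `&` homog b) y by [].
rewrite e; exists 0; first by split; [apply: ideal0|apply: homog0].
by exists y; [exists 1 => //; rewrite scale1r|rewrite add0r].
Qed.

Lemma y0_annihilator : whittaker_annihilator phi y0.
Proof. exact: dsum_annihilator gphi_even. Qed.
Lemma y1_annihilator : whittaker_annihilator phi y1.
Proof. exact: dsum_annihilator gphi_odd. Qed.

Section OneModule.
Variable V : lieSupermodType g.
Local Notation whit := (whittaker_vectors phi (V := V)).
Implicit Types (u v m : V).

Lemma whittaker_y0 m : whit m -> whit (act y0 m).
Proof. exact: whittaker_act hy0 y0_annihilator. Qed.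

Lemma whittaker_y1 m : whit m -> whit (act y1 m).
Proof. exact: whittaker_act hy1 y1_annihilator. Qed.

Lemma y1y1_whittaker m : whit m ->
  act y1 (act y1 m) = 2^-1 *: (lambda *: act y0 m + chi phi p0 *: m).
Proof.
move=> hm; have := act_bracket m hy1 hy1.
rewrite y1y1 act_linl hm expr1 scaleN1r opprK -mulr2n -scaler_nat => ->.
by rewrite scalerA mulVf ?pnatr_eq0 // scale1r.
Qed.

Lemma y0y1_whittaker m : whit m ->
  act y0 (act y1 m) = act y1 (act y0 m) + mu *: act y1 m.
Proof.
move=> hm; have := act_bracket m hy0 hy1.
rewrite y0y1 act_linl hm [phi p1 : K](chi_odd phi hp1) scale0r addr0 scale1r => ->.
by rewrite addrC subrK.
Qed.

Definition stable (M : set V) : Prop :=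
  [/\ forall (c : K) u v, M u -> M v -> M (c *: u + v), M `<=` whit,
      forall m, M m -> M (act y0 m) & forall m, M m -> M (act y1 m)].

(** In each parity g^phi is the part of [p], acting on [M] by scalars, plus the line of [y0] or
    [y1]. *)
Lemma stable_annihilator (M : set V) b (z : g) m : stable M ->
  homog b z -> whittaker_annihilator phi z -> M m -> M (act z m).
Proof.
move=> [M_lin M_whit M_y0 M_y1] hz az Mm.
have [q [y [pq My ->]]] : exists q y, [/\ ideal_set p q, M (act y m) & z = q + y].
  have M0 : M 0 by have := M_lin (-1) _ _ Mm Mm; rewrite scaleN1r addNr.
  case: b hz => hz; [move: gphi_odd|move: gphi_even] => -[e _].
    have : (whittaker_annihilator phi `&` homog true) z by [].
    rewrite e => -[q [pq _] [_ [c _ <-] <-]]; exists q, (c *: y1); split=> //.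
    by rewrite actZl -[_ *: _]addr0; apply/M_lin/M0/M_y1.
  have : (whittaker_annihilator phi `&` homog false) z by [].
  rewrite e => -[q [pq _] [_ [c _ <-] <-]]; exists q, (c *: y0); split=> //.
  by rewrite actZl -[_ *: _]addr0; apply/M_lin/M0/M_y0.
by rewrite actDl [act q m](M_whit _ Mm (ideal_in pq)); apply: M_lin.
Qed.

Section StableGenerating.
Variables (M : set V) (w : V).
Hypotheses (sM : stable M) (Mw : M w) (w_gen : usubmod w = setT).

Lemma stable0 : M 0.
Proof. by case: sM => h _ _ _; have := h (-1) _ _ Mw Mw; rewrite scaleN1r addNr. Qed.

Lemma stable_filt v : exists k, filt M setT k v.
Proof.
have : usubmod w v by rewrite w_gen.
by move=> [a _ <-]; apply: filt_uact; exists 1%N; apply: filtM.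
Qed.

(** The filtration started at [M] exhausts [V] because [w] generates, so [filt_whittaker] applies to
    every Whittaker vector. *)
Lemma stable_whittaker : whit `<=` M.
Proof.
case: (sM) => M_lin M_whit _ _ v; have [k hk] := stable_filt v.
apply: filt_whittaker hk => //; first exact: stable0.
by move=> b z m; apply: stable_annihilator.
Qed.

Lemma stable_meets (N : set V) v :
  (forall (c : K) u w, N u -> N w -> N (c *: u + w)) ->
  (forall (x : g) u, N u -> N (act x u)) ->
  N v -> v <> 0 -> exists m, [/\ M m, N m & m <> 0].
Proof.
case: (sM) => M_lin M_whit _ _ N_lin N_act; have [k hk] := stable_filt v.
apply: (filt_meets stable0 M_lin M_whit _ N_lin N_act hk) => b z m.
exact: stable_annihilator.
Qed.
End StableGenerating.

Definition plane u v : set V := [set w | exists a b : K, w = a *: u + b *: v].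

Definition eigen (xi : K) v := whit v /\ act y0 v = xi *: v.

(** The scalar whose vanishing selects the second case of [Lxi]; on eigenvectors of value [xi] the
    square of [y1] is half of it. *)
Definition kappa (xi : K) : K := lambda * xi + chi phi p0.

Lemma eigen_y1 xi v : eigen xi v -> eigen (xi + mu) (act y1 v).
Proof.
move=> [hv ev]; split; first exact: whittaker_y1.
by rewrite y0y1_whittaker // ev actZr -scalerDl.
Qed.

Lemma eigen_y1y1 xi v : eigen xi v -> act y1 (act y1 v) = (2^-1 * kappa xi) *: v.
Proof. by move=> [hv ev]; rewrite y1y1_whittaker // ev !scalerA -scalerDl scalerA. Qed.

Lemma plane_stable xi v : eigen xi v -> stable (plane v (act y1 v)).
Proof.
move=> ev; have [wv yv] := ev; have [wv1 yv1] := eigen_y1 ev; split.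
- move=> c _ _ [a [b ->]] [a' [b' ->]]; exists (c * a + a'), (c * b + b').
  by rewrite scalerDr !scalerDl !scalerA addrACA.
- move=> _ [a [b ->]]; apply: whittaker_lin => //.
  by rewrite -[_ *: _]addr0; apply/whittaker_lin/whittaker0.
- move=> _ [a [b ->]]; exists (a * xi), (b * (xi + mu)).
  by rewrite act_linr actZr yv yv1 !scalerA.
- move=> _ [a [b ->]]; exists (b * (2^-1 * kappa xi)), a.
  by rewrite act_linr actZr (eigen_y1y1 ev) scalerA addrC.
Qed.

Lemma plane_l u v : plane u v u.
Proof. by exists 1, 0; rewrite scale1r scale0r addr0. Qed.

(** By [eigen_y1] twice, [act y1 (act y1 v)] has eigenvalue [xi + mu + mu]; yet it is [kappa xi / 2]
    times [v], whose eigenvalue is [xi]. *)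
Lemma mu_kappa xi v : v <> 0 -> eigen xi v -> mu * kappa xi = 0.
Proof.
move=> nz ev; have [_ yv] := ev; have [_] := eigen_y1 (eigen_y1 ev).
rewrite (eigen_y1y1 ev) actZr yv scalerA => /eqP.
rewrite -subr_eq0 scalerA -scalerBl scaler_eq0 => /orP[|/eqP //].
rewrite [_ * xi]mulrC -mulrBl !opprD !addrA subrr add0r mulf_eq0.
rewrite mulf_eq0 invr_eq0 pnatr_eq0 /= -opprD oppr_eq0 -mulr2n -mulr_natl.
by rewrite mulf_eq0 pnatr_eq0 /= -mulf_eq0 => /eqP.
Qed.

(** * The eigenvalue of y0 on an irreducible supermodule *)

Section Irreducible.
Hypothesis irrV : irreducible_supermod V.

(** If [act y1 v] were nonzero it would generate [V], so [v] would lie in its span with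
    [act y1 (act y1 v)], which is zero; [v] would then be a multiple of a vector of opposite
    parity. *)
Lemma y1_vanish b xi v : homog b v -> v <> 0 -> eigen xi v -> kappa xi = 0 ->
  act y1 v = 0.
Proof.
move=> hv nz ev k0; apply: contrapT => nz1.
have hv1 : homog (~~ b) (act y1 v) := act_homog hy1 hv.
have gen1 := irreducible_generated irrV hv1 nz1.
have [wv _] := ev.
have [a [c e]] := stable_whittaker (plane_stable (eigen_y1 ev)) (plane_l _ _) gen1 wv.
apply: nz; apply: homog_capb hv _; rewrite e (eigen_y1y1 ev) k0 mulr0 scale0r.
by rewrite scaler0 addr0; apply: homogZ.
Qed.

(** V_phi is spanned by [v] and [act y1 v], with eigenvalues [xi] and [xi + mu]. By [mu_kappa]
    either [mu = 0], or [kappa xi = 0] and [act y1 v = 0]; in both cases [mu *: act y1 v = 0]. *)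
Lemma whittaker_eigen b xi v u : homog b v -> v <> 0 -> eigen xi v ->
  whit u -> eigen xi u.
Proof.
move=> hv nz ev wu; split=> //; have gen := irreducible_generated irrV hv nz.
have [a [c ->]] := stable_whittaker (plane_stable ev) (plane_l _ _) gen wu.
have [_ yv] := ev; have [_ yv1] := eigen_y1 ev.
have e1 : mu *: act y1 v = 0.
  have [k0|k0] := eqVneq (kappa xi) 0.
    by rewrite (y1_vanish hv nz ev k0) scaler0.
  have /eqP := mu_kappa nz ev; rewrite mulf_eq0 (negbTE k0) orbF => /eqP ->.
  by rewrite scale0r.
rewrite act_linr actZr yv yv1 scalerDl e1 addr0 scalerDr !scalerA.
by rewrite [a * xi]mulrC [c * xi]mulrC.
Qed.

(** The stable subspace is built on [act y0 u] and not on [u]: since [u] must lie in it, [u] becomes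
    a polynomial in [y0] applied to [act y0 u], and so a nonzero polynomial in [y0] kills [u]. *)
Lemma eigen_exists : quasi_whittaker phi V ->
  exists b v xi, [/\ homog b v, v <> 0 & eigen xi v].
Proof.
move=> [b [u [hu wu gen]]].
have nzu : u <> 0.
  move=> u0; have [v hv] := irrV.1; apply: hv.
  have : usubmod u v by rewrite gen.
  by move=> [a _ <-]; rewrite u0; have [_ _ ->] := lin_D (@uact_lin _ _ V a).
have [yu|yu] := pselect (act y0 u = 0).
  by exists b, u, 0; split=> //; split=> //; rewrite yu scale0r.
set u' := act y0 u in yu.
have hu' : homog b u' by exact: act_homog hy0 hu.
have gen' := irreducible_generated irrV hu' yu.
have wu' : whit u' := whittaker_y0 wu.
pose A0 : set V := range (fun P => polact y0 P u').
pose A1 : set V := range (fun P => polact y0 P (act y1 u')).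
have A_lin w (c : K) v v' : range (fun P => polact y0 P w) v ->
    range (fun P => polact y0 P w) v' ->
    range (fun P => polact y0 P w) (c *: v + v').
  by move=> [P _ <-] [Q _ <-]; exists (c *: P + Q) => //; rewrite polact_linl.
have A_y0 w v : range (fun P => polact y0 P w) v ->
    range (fun P => polact y0 P w) (act y0 v).
  by move=> [P _ <-]; exists (P * 'X) => //; rewrite polactXM.
have A_base w : range (fun P => polact y0 P w) w.
  by exists 1 => //; rewrite -polyC1 polactC scale1r.
have A_whit w v : whit w -> range (fun P => polact y0 P w) v -> whit v.
  move=> ww [P _ <-]; apply: polact_ind => // [c x y|x]; first exact: whittaker_lin.
  exact: whittaker_y0.
have A_homog d w v : homog d w -> range (fun P => polact y0 P w) v -> homog d v.
  move=> hw [P _ <-]; apply: (@polact_ind _ _ _ _ (homog d)) => // [c x y|x hx].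
    exact: homogP.
  exact: act_homog hy0 hx.
(* [y1] commutes with [y0] up to [mu], so it is enough to control [y1] on the base vector [w]. *)
have A_y1 w w' v : whit w -> range (fun P => polact y0 P w') (act y1 w) ->
    range (fun P => polact y0 P w) v -> range (fun P => polact y0 P w') (act y1 v).
  move=> ww hw [P _ <-].
  suff [] : [set x | whit x /\ range (fun P => polact y0 P w') (act y1 x)]
    (polact y0 P w) by [].
  apply: polact_ind => // [c x y [hx kx] [hy ky]|x [hx kx]].
    by split; [apply: whittaker_lin|rewrite act_linr; apply: A_lin].
  split; first exact: whittaker_y0.
  have -> : act y1 (act y0 x) = - mu *: act y1 x + act y0 (act y1 x).
    by rewrite y0y1_whittaker // scaleNr addrC addrK.
  by apply: A_lin => //; apply: A_y0.
have wy1 := whittaker_y1 wu'.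
have y1y1A : A0 (act y1 (act y1 u')).
  rewrite y1y1_whittaker // scalerDr scalerA; apply: A_lin; first exact/A_y0/A_base.
  by exists (2^-1 *: (chi phi p0)%:P) => //; rewrite -[_ *: _]addr0 polact_linl polactC;
     rewrite -polyC0 polactC scale0r addr0.
pose M : set V := [set v | exists a0 a1, [/\ A0 a0, A1 a1 & v = a0 + a1]].
have sM : stable M.
  split.
  - move=> c _ _ [a [a1 [h h1 ->]]] [a' [a1' [h' h1' ->]]].
    exists (c *: a + a'), (c *: a1 + a1'); split; try exact: A_lin.
    by rewrite scalerDr addrACA.
  - move=> _ [a [a1 [h h1 ->]]]; rewrite -[a]scale1r.
    by apply: whittaker_lin; [apply: A_whit h|apply: A_whit h1].
  - move=> _ [a [a1 [h h1 ->]]]; exists (act y0 a), (act y0 a1).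
    by split; [apply: A_y0|apply: A_y0|rewrite actDr].
  - move=> _ [a [a1 [h h1 ->]]]; exists (act y1 a1), (act y1 a).
    split; [exact: A_y1 h1|exact: A_y1 h|by rewrite actDr addrC].
have Mu' : M u'.
  exists u', 0; rewrite addr0; split=> //; first exact: A_base.
  by exists 0 => //; rewrite -polyC0 polactC scale0r.
have [a [a1 [h h1 e]]] := stable_whittaker sM Mu' gen' wu.
have ha : homog b a by apply: A_homog h.
have ha1 : homog (~~ b) a1 by apply: A_homog h1; apply: act_homog hy1 hu'.
(* [A1] has the parity opposite to that of [u], so only [A0] contributes. *)
have a10 : a1 = 0.
  apply: homog_capb (ha1).
  have -> : a1 = u - a by rewrite e addrC addrA addNr add0r.
  by apply: homogD => //; apply: homogN.
have [P _ eP] := h.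
have R0 : P * 'X - 1 != 0.
  apply/eqP => /(congr1 (fun Q : {poly K} => Q`_0)).
  by rewrite coefB coefMX coef1 coef0 /= sub0r => /eqP; rewrite oppr_eq0 oner_eq0.
have Ru : polact y0 (P * 'X - 1) u = 0.
  rewrite polactD -polyC1 -polyCN polactC scaleN1r polactM polactX eP.
  by rewrite e a10 addr0 subrr.
have [Q [xi [nzQ eQ]]] := eigenvector R0 nzu Ru.
have rQ : range (fun P => polact y0 P u) (polact y0 Q u) by exists Q.
exists b, (polact y0 Q u), xi; split=> //; first exact: A_homog rQ.
by split=> //; apply: A_whit rQ.
Qed.

End Irreducible.
End OneModule.

(** * Comparison with L_xi *)

Lemma shom_eigen (V W : lieSupermodType g) (f : V -> W) d xi v :
  shom d f -> eigen xi v -> eigen xi (f v).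
Proof.
move=> [f_lin f_act _] [wv yv]; have [_ fZ _] := lin_D f_lin.
by split=> [q|]; rewrite -f_act ?yv ?wv fZ.
Qed.

Local Notation Ltil := (Ltilde phi hy0).
Local Notation L := (Lxi phi hy0 hy1 lambda p0).

Definition wtilde xi : Ltil xi := qpi _ (wphi phi).

Lemma wtilde_eigen xi : eigen xi (wtilde xi).
Proof.
have hs := qpi_shom (cyclic (y0_xi_even phi hy0 xi)).
have [f_lin f_act _] := hs; have [fD fZ _] := lin_D f_lin; split=> [q|].
  by rewrite -f_act wphi_whittaker fZ.
rewrite /wtilde -f_act -fZ; apply/qpiP.
by exists 1 => //; rewrite uact1 uactDl uact_gen -scaleNr uactZl uact1 scaleNr.
Qed.

Lemma wtilde_generates xi : usubmod (wtilde xi) = setT.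
Proof. exact/quot_generated/wphi_generates. Qed.

Lemma Lxi_eigen xi : exists w : L xi, eigen xi w /\ usubmod w = setT.
Proof.
rewrite /Lxi; case: ifP => _.
  by exists (wtilde xi); split; [apply: wtilde_eigen|apply: wtilde_generates].
exists (qpi _ (wtilde xi)); split; last exact/quot_generated/wtilde_generates.
exact: shom_eigen (qpi_shom _) (wtilde_eigen xi).
Qed.

Lemma Ltilde_lift (V : lieSupermodType g) b xi (v : V) :
  homog b v -> eigen xi v ->
  exists2 f : Ltil xi -> V, shom b f & f (wtilde xi) = v.
Proof.
move=> hv [wv yv]; have [f sf fw] := Wphi_lift wv hv.
have [n|f' sf' f'E] := quot_lift (N := cyclic (y0_xi_even phi hy0 xi)) sf.
  move=> [a _ <-]; rewrite !(shom_uact _ _ sf) fw uactDl uact_gen yv.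
  rewrite -scaleNr uactZl uact1 scaleNr subrr.
  by have [_ _ ->] := lin_D (@uact_lin _ _ V a).
by exists f' => //; rewrite f'E.
Qed.

(** Surjectivity holds because [f w] generates. A nonzero kernel, being a submodule, would meet the
    plane of [w] and [act y1 w] by [stable_meets]. *)
Lemma shom_iso_of_plane (U V : lieSupermodType g) (f : U -> V) d xi (w : U) :
  shom d f -> eigen xi w -> usubmod w = setT -> usubmod (f w) = setT ->
  (forall a b : K, f (a *: w + b *: act y1 w) = 0 -> a *: w + b *: act y1 w = 0) ->
  iso_up_to_parity V U.
Proof.
move=> sf ew genU genV f_plane; apply: (shom_iso sf).
have [f_lin f_act _] := sf; have [fD fZ f0] := lin_D f_lin.
have f_ker v : f v = 0 -> v = 0.
  move=> fv; apply: contrapT => nz.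
  have k_lin (c : K) x y : f x = 0 -> f y = 0 -> f (c *: x + y) = 0.
    by move=> fx fy; rewrite f_lin fx fy scaler0 addr0.
  have k_act (x : g) y : f y = 0 -> f (act x y) = 0.
    by move=> fy; rewrite f_act fy actr0.
  have [_ [[a [c ->]] /f_plane //]] := stable_meets (plane_stable ew)
    (plane_l _ _) genU (N := [set x | f x = 0]) k_lin k_act fv nz.
have f_inj : injective f.
  move=> x y e; apply/eqP; rewrite -subr_eq0; apply/eqP/f_ker.
  by rewrite -scaleN1r fD fZ e scaleN1r subrr.
have f_surj y : exists x, f x = y.
  have : usubmod (f w) y by rewrite genV.
  by move=> [a _ <-]; exists (uact a w); rewrite (shom_uact _ _ sf).
have [h hK] := choice f_surj.
by exists h => // x; apply: f_inj; rewrite hK.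
Qed.

Lemma iso_Lxi (V : lieSupermodType g) b xi (v : V) :
  irreducible_supermod V -> homog b v -> v <> 0 -> eigen xi v ->
  iso_up_to_parity V (L xi).
Proof.
move=> irrV hv nz ev; have gen := irreducible_generated irrV hv nz.
have [f sf fw] := Ltilde_lift hv ev.
have hv1 : homog (~~ b) (act y1 v) := act_homog hy1 hv.
rewrite /Lxi; case: ifPn => [k0|/negPn/eqP k0].
  apply: (shom_iso_of_plane sf (wtilde_eigen xi)) => [||a c].
  - exact: wtilde_generates.
  - by rewrite fw.
  have [f_lin f_act _] := sf; have [fD fZ f0] := lin_D f_lin.
  rewrite f_lin fZ f_act fw => e.
  (* [v] and [act y1 v] have opposite parities, so both terms of the relation vanish. *)
  have ac : a *: v = 0.
    apply: homog_capb (homogZ a hv) _.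
    have -> : a *: v = - c *: act y1 v.
      by apply/eqP; rewrite scaleNr -addr_eq0 e.
    exact: homogZ.
  move: (e); rewrite ac add0r => ec.
  (* Applying [y1] once more gives [c * kappa xi / 2] times [v], and [kappa xi] is nonzero in this
     case. *)
  have -> : c = 0.
    apply/eqP; move: (congr1 (act y1) ec); rewrite actZr actr0 (eigen_y1y1 ev).
    rewrite scalerA => /eqP; rewrite scaler_eq0 => /orP[|/eqP //].
    by rewrite !mulf_eq0 invr_eq0 pnatr_eq0 /= [kappa _ == 0](negbTE k0) orbF.
  move/eqP: ac; rewrite scaler_eq0 => /orP[/eqP ->|/eqP //].
  by rewrite !scale0r addr0.
(* In the other case [act y1 v = 0], so the map descends to the second quotient, where the plane
   shrinks to the line of the generator. *)
have y1v := y1_vanish irrV hv nz ev k0.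
have sq := qpi_shom (cyclic (y1_wbar_odd phi hy0 hy1 xi)).
have [n|f' sf' f'E] := quot_lift (N := cyclic (y1_wbar_odd phi hy0 hy1 xi)) sf.
  move=> [a _ <-]; rewrite (shom_uact _ _ sf) /y1_wbar.
  have [_ q_act _] := qpi_shom (cyclic (y0_xi_even phi hy0 xi)).
  have [_ f_act _] := sf.
  rewrite q_act f_act fw y1v.
  by have [_ _ ->] := lin_D (@uact_lin _ _ V a).
apply: (shom_iso_of_plane sf' (shom_eigen sq (wtilde_eigen xi))) => [||a c].
- exact/quot_generated/wtilde_generates.
- by rewrite f'E fw.
have [f_lin f_act _] := sf'; have [fD fZ f0] := lin_D f_lin.
have [_ q_act _] := sq.
have q0 : act y1 (qpi (cyclic (y1_wbar_odd phi hy0 hy1 xi)) (wtilde xi)) = 0.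
  rewrite -q_act; apply: qpi_eq0; exists 1 => //; rewrite uact1 /y1_wbar.
  by have [_ -> _] := qpi_shom (cyclic (y0_xi_even phi hy0 xi)).
rewrite q0 scaler0 addr0 fZ f'E fw => /eqP; rewrite scaler_eq0 => /orP[/eqP ->|/eqP //].
by rewrite scale0r.
Qed.

(** The generator of [L xi] is pulled back; if its preimage were zero, [L xi] and hence [V] would be
    zero. *)
Lemma iso_eigen (V : lieSupermodType g) xi : (exists v : V, v <> 0) ->
  iso_up_to_parity V (L xi) -> exists v : V, v <> 0 /\ eigen xi v.
Proof.
move=> [v nz] iso; have [w [[ww yw] gen]] := Lxi_eigen xi.
(* Parity is dropped to treat both alternatives at once: a shifted module has the same vectors and
   the same action. *)
have [f [f_lin [h fK hK] f_act]] : exists f : V -> L xi,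
    [/\ linear f, bijective f & forall (x : g) v, f (act x v) = act x (f v)].
  by case: iso => -[f [f_lin f_bij _ f_act]]; exists f; split.
have fI := can_inj fK; have [_ fZ f0] := lin_D f_lin.
exists (h w); split=> [hw|].
  apply: nz; apply: fI; have : usubmod w (f v) by rewrite gen.
  move=> [a _ <-]; rewrite -(hK w) hw f0.
  by have [_ _ ->] := lin_D (@uact_lin _ _ (L xi) a).
by split=> [q|]; apply: fI; rewrite f_act fZ hK ?ww ?yw.
Qed.

End Classification.

Theorem theorem3p10 (R : realType) (g : lieSuperalgType R[i]) (p : lieIdeal g)
    (phi : lieHom (ideal_type p) (abelian_line R[i]))
    (y0 y1 : g) (hy0 : homog false y0) (hy1 : homog true y1)
    (y0_neq0 : y0 <> 0) (y1_neq0 : y1 <> 0)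
    (gphi_even : internal_dsum (whittaker_annihilator phi `&` homog false)
       (ideal_set p `&` homog false) (line y0))
    (gphi_odd : internal_dsum (whittaker_annihilator phi `&` homog true)
       (ideal_set p `&` homog true) (line y1))
    (lambda mu : R[i]) (p0 p1 : ideal_type p)
    (hp0 : homog false p0) (hp1 : homog true p1)
    (y1y1 : bracket y1 y1 = lambda *: y0 + ideal_val p0)
    (y0y1 : bracket y0 y1 = mu *: y1 + ideal_val p1)
    (V : lieSupermodType g) :
  irreducible_supermod V -> quasi_whittaker phi V ->
  exists! xi : R[i], iso_up_to_parity V (Lxi phi hy0 hy1 lambda p0 xi).
Proof.
move=> irrV qwV.
have [b [v [xi [hv nz ev]]]] :=
  eigen_exists hy0 hy1 gphi_even gphi_odd hp1 y1y1 y0y1 irrV qwV.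
exists xi; split.
  exact: (iso_Lxi hy0 hy1 gphi_even gphi_odd hp1 y1y1 y0y1 irrV hv nz ev).
(* Uniqueness: an isomorphism with parameter [xi'] yields an eigenvector of value [xi'] in V_phi,
   where [y0] acts by [xi]. *)
move=> xi' iso; have [v' [nz' [wv' yv']]] := iso_eigen irrV.1 iso.
have [_ yv] :=
  whittaker_eigen hy0 hy1 gphi_even gphi_odd hp1 y1y1 y0y1 irrV hv nz ev wv'.
move/eqP: yv; rewrite yv' -subr_eq0 -scalerBl scaler_eq0 subr_eq0.
by case/orP => [/eqP ->|/eqP].
Qed.
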